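(* For each $n$, the standard ordering of $B_n$ has at most a quadratic complexity: given two $n$-strand braid words $u,v$ of length $\ell$, one can decide whether the braid represented by $u$ is smaller than the braid represented by $v$ in time $O(\ell^2)$.
   Context: $B_n$ is the $n$-strand braid group, generated by $\sigma_1,\ldots,\sigma_{n-1}$ with relations $\sigma_i\sigma_j=\sigma_j\sigma_i$ for $|i-j|\ge2$ and $\sigma_i\sigma_j\sigma_i=\sigma_j\sigma_i\sigma_j$ for $|i-j|=1$. An $n$-strand braid word is a word in the letters $\sigma_1^{\pm1},\ldots,\sigma_{n-1}^{\pm1}$. The standard ordering: for braids $x,y$, $x<y$ means that $x^{-1}y$ admits at least one word representative in which the generator $\sigma_i$ of maximal index occurs positively only, i.e., $\sigma_i$ occurs but $\sigma_i^{-1}$ does not. This is a linear ordering of $B_n$. Here $n$ is fixed. *)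

(* Defs.v *)
From HB Require Import structures.
From mathcomp Require Export all_boot.
From mathcomp Require Import boolp.

Set Implicit Arguments.
Unset Strict Implicit.
Unset Printing Implicit Defensive.

Local Open Scope quotient_scope.
Local Open Scope group_scope.

(* Indices start at 0: [(i, true)] is sigma_{i+1} and [(i, false)] its
   inverse. *)
Notation letter n := ('I_n.-1 * bool)%type.

Notation braid_word n := (seq (letter n)).

Definition inv_word n (w : braid_word n) : braid_word n :=
  rev [seq (a.1, ~~ a.2) | a <- w].

Inductive braid_equiv n : braid_word n -> braid_word n -> Prop :=
| BE_free i b : braid_equiv [:: (i, b); (i, ~~ b)] [::]
| BE_comm (i j : 'I_n.-1) : (i + 2 <= j)%N || (j + 2 <= i)%N ->
    braid_equiv [:: (i, true); (j, true)] [:: (j, true); (i, true)]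
| BE_braid (i j : 'I_n.-1) : (i + 1 == j)%N || (j + 1 == i)%N ->
    braid_equiv [:: (i, true); (j, true); (i, true)]
                [:: (j, true); (i, true); (j, true)]
| BE_ctx s t u v : braid_equiv u v -> braid_equiv (s ++ u ++ t) (s ++ v ++ t)
| BE_refl u : braid_equiv u u
| BE_sym u v : braid_equiv u v -> braid_equiv v u
| BE_trans u v w : braid_equiv u v -> braid_equiv v w -> braid_equiv u w.

Section BraidGroup.
Variable n : nat.
Implicit Types u v w : braid_word n.

(* Classical truth value, used only to form the quotient. *)
Definition braid_equivb u v : bool := `[< braid_equiv u v >].

Lemma braid_equivb_refl : reflexive braid_equivb.
Proof. by move=> u; apply/asboolP; apply: BE_refl. Qed.

Lemma braid_equivb_sym : symmetric braid_equivb.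
Proof. by move=> u v; apply/asboolP/asboolP; apply: BE_sym. Qed.

Lemma braid_equivb_trans : transitive braid_equivb.
Proof.
by move=> v u w /asboolP uv /asboolP vw; apply/asboolP; apply: BE_trans uv vw.
Qed.

Canonical braid_equivb_rel := EquivRel braid_equivb
  braid_equivb_refl braid_equivb_sym braid_equivb_trans.

Definition braid : Type := {eq_quot braid_equivb}.

HB.instance Definition _ := Choice.on braid.
HB.instance Definition _ := EqQuotient.on braid.

Definition braid_of (w : braid_word n) : braid := \pi_braid w.

Lemma braid_ofP u v : braid_of u = braid_of v <-> braid_equiv u v.
Proof. by split=> [/eqmodP/asboolP | ?] //; apply/eqmodP/asboolP. Qed.

Lemma braid_of_repr (x : braid) : braid_of (repr x) = x.
Proof. exact: reprK. Qed.

Lemma repr_braid_of w : braid_equiv (repr (braid_of w)) w.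
Proof. by apply/braid_ofP; rewrite braid_of_repr. Qed.

Lemma braid_equiv_cat u u' v v' :
  braid_equiv u u' -> braid_equiv v v' -> braid_equiv (u ++ v) (u' ++ v').
Proof.
move=> uu' vv'; apply: (@BE_trans n _ (u' ++ v)).
  exact: (BE_ctx [::] v uu').
by have := BE_ctx u' [::] vv'; rewrite !cats0.
Qed.

Lemma inv_word_cat u v : inv_word (u ++ v) = inv_word v ++ inv_word u.
Proof. by rewrite /inv_word map_cat rev_cat. Qed.

Lemma inv_wordK : involutive (@inv_word n).
Proof.
move=> u; rewrite /inv_word map_rev revK -map_comp map_id_in // => -[i b] _ /=.
by rewrite negbK.
Qed.

Lemma braid_equiv_catV u : braid_equiv (u ++ inv_word u) [::].
Proof.
elim: u => [|[i b] u IHu]; first exact: BE_refl.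
have -> : ((i, b) :: u) ++ inv_word ((i, b) :: u)
        = [:: (i, b)] ++ (u ++ inv_word u) ++ [:: (i, ~~ b)].
  by rewrite -cat1s inv_word_cat -!catA.
exact: BE_trans (BE_ctx [:: (i, b)] [:: (i, ~~ b)] IHu) (BE_free i b).
Qed.

Lemma braid_equiv_catVl u : braid_equiv (inv_word u ++ u) [::].
Proof. by have := braid_equiv_catV (inv_word u); rewrite inv_wordK. Qed.

Lemma braid_equiv_inv u v :
  braid_equiv u v -> braid_equiv (inv_word u) (inv_word v).
Proof.
move=> uv; apply: (@BE_trans n _ (inv_word u ++ (v ++ inv_word v))).
  rewrite -{1}(cats0 (inv_word u)); apply: braid_equiv_cat (BE_refl _) _.
  exact/BE_sym/braid_equiv_catV.
rewrite catA; apply: (@BE_trans n _ ((inv_word u ++ u) ++ inv_word v)).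
  apply: braid_equiv_cat (BE_refl _); apply: braid_equiv_cat (BE_refl _) _.
  exact: BE_sym.
exact: braid_equiv_cat (braid_equiv_catVl u) (BE_refl _).
Qed.

Definition braid_one : braid := braid_of [::].
Definition braid_mul (x y : braid) : braid := braid_of (repr x ++ repr y).
Definition braid_inv (x : braid) : braid := braid_of (inv_word (repr x)).

Lemma braid_mulE u v : braid_mul (braid_of u) (braid_of v) = braid_of (u ++ v).
Proof. by apply/braid_ofP; apply: braid_equiv_cat; apply: repr_braid_of. Qed.

Lemma braid_invE u : braid_inv (braid_of u) = braid_of (inv_word u).
Proof. exact/braid_ofP/braid_equiv_inv/repr_braid_of. Qed.

Lemma braid_mulA : associative braid_mul.
Proof.
move=> x y z.
rewrite -(braid_of_repr x) -(braid_of_repr y) -(braid_of_repr z).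
by rewrite !braid_mulE catA.
Qed.

Lemma braid_mul1 : left_id braid_one braid_mul.
Proof. by move=> x; rewrite -(braid_of_repr x) braid_mulE. Qed.

Lemma braid_mulr1 : right_id braid_one braid_mul.
Proof. by move=> x; rewrite -(braid_of_repr x) braid_mulE cats0. Qed.

Lemma braid_mulV : left_inverse braid_one braid_inv braid_mul.
Proof.
move=> x; rewrite -(braid_of_repr x) braid_invE braid_mulE.
exact/braid_ofP/braid_equiv_catVl.
Qed.

Lemma braid_mulrV : right_inverse braid_one braid_inv braid_mul.
Proof.
move=> x; rewrite -(braid_of_repr x) braid_invE braid_mulE.
exact/braid_ofP/braid_equiv_catV.
Qed.

HB.instance Definition _ := isGroup.Build braid
  braid_mulA braid_mul1 braid_mulr1 braid_mulV braid_mulrV.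

Lemma braid_of_cat u v : braid_of (u ++ v) = braid_of u * braid_of v.
Proof. by rewrite -braid_mulE. Qed.

Lemma braid_of_inv u : braid_of (inv_word u) = (braid_of u)^-1.
Proof. by rewrite -braid_invE. Qed.

Definition max_positive (w : braid_word n) : Prop :=
  exists i : 'I_n.-1,
    [/\ (i, true) \in w, (i, false) \notin w
      & forall a : letter n, a \in w -> (a.1 <= i)%N].

Definition braid_lt (x y : braid) : Prop :=
  exists w : braid_word n, braid_of w = x^-1 * y /\ max_positive w.

End BraidGroup.

Inductive move := Left | Right | Stay.

(* A deterministic multitape Turing machine with input alphabet [A]; [None] is
   the blank symbol. *)
Record machine (A : finType) := Machine {
  ntapes : nat;      (* [ntapes.+1] tapes *)
  work : finType;
  state : finType;
  init : state;
  verdict : state -> option bool;  (* [Some b]: halt with answer [b] *)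
  trans : state -> {ffun 'I_ntapes.+1 -> option (A + work)%type} ->
          state * {ffun 'I_ntapes.+1 -> option (A + work)%type * move}
}.

(* A two-way infinite tape, blank almost everywhere: the scanned cell, and
   the cells on its left and on its right, nearest first; cells beyond the
   ends of the two lists are blank. *)
Record tape (S : Type) := Tape {
  lefts : seq (option S);
  cur : option S;
  rights : seq (option S)
}.

Definition write_move S (t : tape S) (a : option S * move) : tape S :=
  match a.2 with
  | Left => Tape (behead (lefts t)) (head None (lefts t)) (a.1 :: rights t)
  | Right => Tape (a.1 :: lefts t) (head None (rights t)) (behead (rights t))
  | Stay => Tape (lefts t) a.1 (rights t)
  end.

Section Run.
Variables (A : finType) (M : machine A).

Let symbol : Type := (A + work M)%type.

Record config := Config {
  cstate : state M;
  ctapes : {ffun 'I_(ntapes M).+1 -> tape symbol}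
}.

Definition step (c : config) : config :=
  if verdict (cstate c) is Some _ then c else
  let: (q, acts) := trans (cstate c) [ffun k => cur (ctapes c k)] in
  Config q [ffun k => write_move (ctapes c k) (acts k)].

Definition input_tape (x : seq A) : tape symbol :=
  let cells := [seq Some (inl a) | a <- x] in
  Tape [::] (head None cells) (behead cells).

Definition init_config (x : seq A) : config :=
  Config (init M) [ffun k => if k == ord0 then input_tape x
                             else Tape [::] None [::]].

Definition answers_within (x : seq A) (t : nat) (b : bool) : Prop :=
  verdict (cstate (iter t step (init_config x))) = Some b.

End Run.

(* The pair (u, v) is written on the first tape as u, separator, v. The
   separator is the input letter [None], which is not the blank: on the tape it
   appears as [Some (inl None)]. *)
Definition encode_pair n (u v : braid_word n) : seq (option (letter n)) :=
  map Some u ++ None :: map Some v.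

Definition decides_braid_lt_in n (M : machine (option (letter n)))
    (T : nat -> nat) : Prop :=
  forall (l : nat) (u v : braid_word n), size u = l -> size v = l ->
  exists b : bool, answers_within M (encode_pair u v) (T l) b /\
    (b <-> braid_lt (braid_of u) (braid_of v)).

Definition bigO (f g : nat -> nat) : Prop :=
  exists C N : nat, forall l : nat, (N <= l)%N -> (f l <= C * g l)%N.

(* Main.v *)
(* B_n acts on (Z^2)^n by the piecewise-linear maps of Dynnikov: sigma_i acts on
   the i-th and (i+1)-st pairs only, never increases the coordinate x_(i+1), and
   strictly decreases it when y_(i+1) < 0.  Starting from x = 0, y = -1, a braid
   represented by a word in which the generator of maximal index occurs only
   positively (negatively) therefore has its last nonzero x negative (positive).
   Since every nontrivial braid has such a word, the sign of that x decides the
   order.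

   The existence of the word is proved by handle reduction.  The word is drawn
   in the Cayley graph of B_n, inside the finite set of positive divisors of a
   power of a central element; by Garside's theorem this set contains, with two
   edges at a vertex, the polygon of the corresponding relation, so that handle
   reduction does not leave it.  Replacing sigma_m v sigma_m^-1 removes the last
   sigma_m-edge of a positive path, or trades it for edges ending strictly below
   in the order, which is acyclic by the action above; a sum of powers of 2
   decreases.

   The coordinates of a braid of length l have O(l) digits.  They are stored in
   parallel on one tape, and each letter costs a constant number of additions
   and comparisons with 0, i.e. of sweeps over O(l) cells. *)
From HB Require Import structures.
From Stdlib Require Import ZArith Lia Setoid Morphisms.
From mathcomp Require Import boolp.
Require Import Defs.

Set Implicit Arguments.
Unset Strict Implicit.
Unset Printing Implicit Defensive.

(** * A piecewise-linear action of the braid group *)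

Section Crossing.
Local Open Scope Z_scope.
Implicit Types p q r : Z * Z.

(** The formulas are max-plus rational, and the sum of the two y-coordinates is preserved. *)
Definition cross_plus p q : (Z * Z) * (Z * Z) :=
  let N := Z.max (q.1 + p.2) (p.1 + Z.max 0 p.2 + Z.max 0 q.2) in
  ((Z.max (Z.max p.1 q.1 + p.2) p.1, q.1 + p.2 + q.2 - N),
   (p.1 + q.1 + q.2 - Z.max (p.1 + Z.max 0 q.2) q.1, N - q.1)).

Definition mirror p : Z * Z := (- p.1, p.2).

(** Negating both x-coordinates conjugates the map of a crossing into its inverse, so one set of
    formulas serves both signs. *)
Definition cross b p q : (Z * Z) * (Z * Z) :=
  if b then cross_plus p q else
  let r := cross_plus (mirror p) (mirror q) in (mirror r.1, mirror r.2).

(** Only innermost maxima are split, so every case hypothesis is linear; contradictory branches are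
    discarded at once to keep the case tree small. *)
Ltac split_max :=
  repeat match goal with |- context[Z.max ?a ?b] =>
    lazymatch a with context[Z.max _ _] => fail | _ => idtac end;
    lazymatch b with context[Z.max _ _] => fail | _ => idtac end;
    let h := fresh in let e := fresh in
    destruct (Z.max_spec a b) as [[h e]|[h e]]; rewrite -> e in *; clear e;
    try (exfalso; lia)
  end; try lia.

Lemma mirrorK : involutive mirror.
Proof. by case=> a b; rewrite /mirror /= Z.opp_involutive. Qed.

Lemma crossK b p q :
  cross (~~ b) (cross b p q).1 (cross b p q).2 = (p, q).
Proof.
have K r s : cross false (cross true r s).1 (cross true r s).2 = (r, s).
  case: r s => [x y] [z t]; rewrite /cross /= /mirror /cross_plus /=.
  by congr (_, _, (_, _)); split_max.
case: b; first exact: K.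
have K1 := congr1 fst (K (mirror p) (mirror q)).
have K2 := congr1 snd (K (mirror p) (mirror q)).
rewrite /cross [LHS]surjective_pairing.
by congr (_, _); apply: (can_inj mirrorK); [exact: K1 | exact: K2].
Qed.

(** Naming the three maxima keeps the coordinates of composed crossings linear; the maxima are
    unfolded only where they matter. *)
Lemma cross_plusE a b c d : exists P N Q : Z,
  [/\ cross_plus (a, b) (c, d)
      = ((P, c + b + d - N), (a + c + d - Q, N - c)),
      P = Z.max (Z.max a c + b) a,
      N = Z.max (c + b) (a + Z.max 0 b + Z.max 0 d) &
      Q = Z.max (a + Z.max 0 d) c].
Proof. by do 3 eexists. Qed.

Definition cross12 (t : (Z * Z) * (Z * Z) * (Z * Z)) :=
  let: (p, q, r) := t in let: (p', q') := cross_plus p q in (p', q', r).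
Definition cross23 (t : (Z * Z) * (Z * Z) * (Z * Z)) :=
  let: (p, q, r) := t in let: (q', r') := cross_plus q r in (p, q', r').

(** Five coordinates are compared by splitting maxima. The sixth, a y-coordinate, follows because
    crossings preserve the sum of the y-coordinates. *)
Lemma yang_baxter t : cross12 (cross23 (cross12 t)) = cross23 (cross12 (cross23 t)).
Proof.
case: t => [[[a b] [c d]] [e f]]; rewrite /cross12 /cross23.
have [P1 [N1 [Q1 [-> hP1 hN1 hQ1]]]] := cross_plusE a b c d.
have [P2 [N2 [Q2 [-> hP2 hN2 hQ2]]]] := cross_plusE (a + c + d - Q1) (N1 - c) e f.
have [P3 [N3 [Q3 [-> hP3 hN3 hQ3]]]] :=
  cross_plusE P1 (c + b + d - N1) P2 (e + (N1 - c) + f - N2).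
have [P4 [N4 [Q4 [-> hP4 hN4 hQ4]]]] := cross_plusE c d e f.
have [P5 [N5 [Q5 [-> hP5 hN5 hQ5]]]] := cross_plusE a b P4 (e + d + f - N4).
have [P6 [N6 [Q6 [-> hP6 hN6 hQ6]]]] :=
  cross_plusE (a + P4 + (e + d + f - N4) - Q5) (N5 - P4) (c + e + f - Q4) (N4 - e).
have E1 : P3 = P5.
  by rewrite hP3 hP2 hP1 hQ1 hN1 hP5 hP4; clear; split_max.
have E2 : P2 + (c + b + d - N1) + (e + (N1 - c) + f - N2) - N3
        = P4 + b + (e + d + f - N4) - N5.
  by rewrite hN3 hN2 hP2 hP1 hQ1 hN1 hN5 hP4 hN4; clear; split_max.
have E3 : a + c + d - Q1 + e + f - Q2
        = a + P4 + (e + d + f - N4) - Q5 + (c + e + f - Q4) + (N4 - e) - Q6.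
  by rewrite hQ2 hQ1 hQ6 hQ5 hN4 hP4 hQ4; clear; split_max.
have E4 : N2 - e = N6 - (c + e + f - Q4).
  by rewrite hN2 hN1 hQ1 hN6 hN5 hQ5 hN4 hP4 hQ4; clear; split_max.
have E5 : P1 + P2 + (e + (N1 - c) + f - N2) - Q3 = P6.
  by rewrite hQ3 hN2 hP2 hQ1 hN1 hP1 hP6 hQ5 hN5 hN4 hP4 hQ4; clear; split_max.
clear -E1 E2 E3 E4 E5.
by congr (_, _, (_, _), (_, _)) => //; lia.
Qed.

(** A positive generator lowers x, hence [true] goes with negative values. *)
Definition signed b (z : Z) : Prop := if b then z < 0 else 0 < z.

Lemma cross_monotone b p q :
  let d := (cross b p q).2.1 - q.1 in
  (d = 0 \/ signed b d) /\ (q.2 < 0 -> signed b d).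
Proof.
by case: p q b => [a e] [c d] [];
   rewrite /signed /cross /= /mirror /cross_plus /=; split; lia.
Qed.
End Crossing.

From mathcomp Require Import zify.

(** * The action of braid words and the sign of the last nonzero x *)

Section Words.
Variable n : nat.
Implicit Types (u v w : braid_word n) (a : letter n) (m k : nat).
Implicit Types (x : nat -> Z * Z).

Definition low m w := all (fun a => a.1 < m) w.

(** This holds vacuously when the generator is absent; sigma-positivity is the conjunction of
    [low m.+1], [semidef m true] and [occurs m]. *)
Definition semidef m b w := all (fun a => (a.1 == m :> nat) ==> (a.2 == b)) w.

Definition occurs m w := has (fun a => a.1 == m :> nat) w.

Definition act1 x a : nat -> Z * Z :=
  let r := cross a.2 (x a.1) (x a.1.+1) in
  fun k => if k == a.1 then r.1 else if k == a.1.+1 then r.2 else x k.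

Definition act x w := foldl act1 x w.

Definition start (k : nat) : Z * Z := (0, -1)%Z.

Lemma act_cat x u v : act x (u ++ v) = act (act x u) v.
Proof. exact: foldl_cat. Qed.

Lemma act1_far x a k : k != a.1 -> k != a.1.+1 -> act1 x a k = x k.
Proof. by rewrite /act1 => /negPf -> /negPf ->. Qed.

Lemma act1K x i b : act1 (act1 x (i, b)) (i, ~~ b) = x.
Proof.
apply/funext => k; rewrite /act1 /= eqxx.
have -> : (i.+1 == i) = false by apply/negP; lia.
rewrite eqxx crossK /=.
by case: eqP => [->|_] //; case: eqP => [->|].
Qed.

Lemma act1_comm x (a b : letter n) :
    (a.1 + 2 <= b.1) || (b.1 + 2 <= a.1) ->
  act1 (act1 x a) b = act1 (act1 x b) a.
Proof.
move=> ab; apply/funext => k.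
have far (c d : letter n) : (c.1 + 2 <= d.1) || (d.1 + 2 <= c.1) ->
    cross d.2 (act1 x c d.1) (act1 x c d.1.+1) = cross d.2 (x d.1) (x d.1.+1).
  by move=> cd; rewrite !act1_far //; lia.
have E y (c : letter n) : act1 y c k =
    let r := cross c.2 (y c.1) (y c.1.+1) in
    if k == c.1 then r.1 else if k == c.1.+1 then r.2 else y k by [].
have ba : (b.1 + 2 <= a.1) || (a.1 + 2 <= b.1) by rewrite orbC.
rewrite [LHS]E [RHS]E (far a b ab) (far b a ba) /=.
have [ka|ka] := boolP ((k == a.1) || (k == a.1.+1)).
  have -> : act1 x b k = x k by apply: act1_far; lia.
  rewrite (_ : (k == b.1) = false); last by lia.
  rewrite (_ : (k == b.1.+1) = false); last by lia.
  by rewrite E.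
move: ka; rewrite negb_or => /andP[ka ka'].
by rewrite [act1 x a k]act1_far // (negPf ka) (negPf ka').
Qed.

Lemma act1_braid x (i j : 'I_n.-1) : (i + 1 == j) || (j + 1 == i) ->
  act x [:: (i, true); (j, true); (i, true)]
  = act x [:: (j, true); (i, true); (j, true)].
Proof.
wlog ij : i j / i.+1 = j :> nat => [wl|_].
  case/orP => [/eqP|/eqP] e; first by apply: wl; lia.
  by apply/esym/wl; lia.
have n1 : (i.+1 == i :> nat) = false by lia.
have n2 : (i.+2 == i :> nat) = false by lia.
have n3 : (i.+2 == i.+1 :> nat) = false by lia.
have E12 y : (act1 y (i, true) i, act1 y (i, true) i.+1, act1 y (i, true) i.+2)
    = cross12 (y i, y i.+1, y i.+2).
  rewrite /act1 /cross12 /= !eqxx.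
  rewrite n1 n2 n3.
  by [].
have E23 y : (act1 y (j, true) i, act1 y (j, true) i.+1, act1 y (j, true) i.+2)
    = cross23 (y i, y i.+1, y i.+2).
  rewrite /act1 /cross23 /= -ij !eqxx.
  rewrite ![i == _ :> nat]eq_sym n1 n2 n3.
  by [].
apply/funext => k; have [/andP[ik ki]|ki] := boolP (i <= k <= i.+2); last first.
  by rewrite /act /= !act1_far //=; lia.
have := yang_baxter (x i, x i.+1, x i.+2).
rewrite -!E12 -!E23 -!E12 -E23 => -[e0 e1 e2].
have : [|| k == i, k == i.+1 | k == i.+2] by lia.
by case/or3P => /eqP ->; rewrite /act.
Qed.

Lemma act_equiv u v x : braid_equiv u v -> act x u = act x v.
Proof.
move=> uv; elim: uv x => {u v}.
- by move=> i b x; apply: act1K.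
- by move=> i j ij x; apply: act1_comm.
- by move=> i j ij x; apply: act1_braid.
- by move=> s t u v _ IH x; rewrite !act_cat IH.
- by [].
- by move=> u v _ IH x; rewrite IH.
- by move=> u v w _ IHu _ IHv x; rewrite IHu.
Qed.

Lemma act_low m w x k : low m w -> m < k -> act x w k = x k.
Proof.
elim: w x => //= a w IHw x /andP[am lw] mk.
by rewrite -/(act _ w) IHw // act1_far //; lia.
Qed.

Lemma act_semidef_le m b w x : low m.+1 w -> semidef m b w ->
  let d := ((act x w m.+1).1 - (x m.+1).1)%Z in d = 0%Z \/ signed b d.
Proof.
elim: w x => [|a w IHw] x /=; first by left; lia.
move=> /andP[am lw] /andP[sa sw]; have {IHw}/= := IHw (act1 x a) lw sw.
rewrite -/(act _ w) {2 4}/act1.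
case: (eqVneq (m.+1) a.1) => [|_]; first by lia.
case: eqVneq => [[ma]|_] //; move: sa; rewrite -ma eqxx /= => /eqP <-.
have [] := cross_monotone a.2 (x m) (x m.+1).
by rewrite /signed; case: a.2 => /=; lia.
Qed.

Lemma act_semidef m b w : low m.+1 w -> semidef m b w -> occurs m w ->
  signed b (act start w m.+1).1.
Proof.
have : (start m.+1).2 = (-1)%Z /\ (start m.+1).1 = 0%Z by [].
move: start => x.
elim: w x => //= a w IHw x [y0 x0] /andP[am lw] /andP[sa sw].
rewrite -/(act _ w); have [ma _|ma /= mw] := eqVneq (a.1 : nat) m; last first.
  by apply: IHw => //; rewrite act1_far //; lia.
have /= := act_semidef_le (act1 x a) lw sw.
rewrite {2 4}/act1 ma eqxx (_ : (m.+1 == m) = false); last by lia.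
move: sa; rewrite ma eqxx /= => /eqP <-.
have [_] := cross_monotone a.2 (x m) (x m.+1); rewrite y0 x0 => /(_ ltac:(lia)).
by rewrite /signed; case: a.2 => /=; lia.
Qed.

Definition leading b x : Prop :=
  exists k, signed b (x k).1 /\ forall j, k < j -> (x j).1 = 0%Z.

Lemma leading_semidef m b w : low m.+1 w -> semidef m b w -> occurs m w ->
  leading b (act start w).
Proof.
move=> lw sw ow; exists m.+1; split; first exact: act_semidef.
by move=> j mj; rewrite (act_low _ lw).
Qed.

Lemma leading_uniq b x : leading b x -> ~ leading (~~ b) x.
Proof.
move=> [k [sk k0]] [j [sj j0]]; have [kj|jk|e] := ltngtP k j.
- by move: sj; rewrite /signed (k0 _ kj); case: (b) => /=; lia.
- by move: sk; rewrite /signed (j0 _ jk); case: (b) => /=; lia.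
by move: sk sj; rewrite e /signed; case: (b) => /=; lia.
Qed.

(** From [start], [w] moves the x-coordinate at position [m.+1] while [u] fixes it. With [u] empty
    this is the irreflexivity behind the termination of handle reduction. *)
Lemma semidef_nontrivial m b u w :
  low m.+1 w -> semidef m b w -> occurs m w -> low m u -> ~ braid_equiv u w.
Proof.
move=> lw sw ow lu /(@act_equiv _ _ start) e; move: (act_semidef lw sw ow).
by rewrite -e (act_low _ lu) // /signed; case: (b) => /=; lia.
Qed.

End Words.

(** * Least common multiples of positive braids *)

Section Monoid.
Variable k : nat.
Implicit Types (i j h : 'I_k) (s t u v w x y z : seq 'I_k).

Definition far i j := (i + 2 <= j) || (j + 2 <= i).
Definition adj i j := (i + 1 == j) || (j + 1 == i).

Inductive pstep : seq 'I_k -> seq 'I_k -> Prop :=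
| PS_comm i j t : far i j -> pstep (i :: j :: t) (j :: i :: t)
| PS_braid i j t : adj i j -> pstep (i :: j :: i :: t) (j :: i :: j :: t)
| PS_cons i s t : pstep s t -> pstep (i :: s) (i :: t).

(** A chain of single steps, rather than a congruence closure, allows induction along the chain in
    Garside's lemma. *)
Inductive peq : seq 'I_k -> seq 'I_k -> Prop :=
| PE_refl s : peq s s
| PE_step s t u : pstep s t -> peq t u -> peq s u.

Hint Resolve PE_refl : core.

Lemma farC i j : far i j = far j i.
Proof. by rewrite /far orbC. Qed.

Lemma adjC i j : adj i j = adj j i.
Proof. by rewrite /adj orbC. Qed.

Lemma pstep_sym s t : pstep s t -> pstep t s.
Proof.
elim=> {s t} [i j t ij|i j t ij|i s t _ IH].
- by apply: PS_comm; rewrite farC.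
- by apply: PS_braid; rewrite adjC.
- exact: PS_cons.
Qed.

Lemma peq_trans s t u : peq s t -> peq t u -> peq s u.
Proof. by elim=> // {}s {}t v st _ IH /IH; apply: PE_step. Qed.

Lemma peq_sym s t : peq s t -> peq t s.
Proof.
elim=> [u|{}s {}t u st _ IH]; first exact: PE_refl.
by apply: peq_trans IH _; apply: PE_step (pstep_sym st) (PE_refl _).
Qed.

Lemma peq_cons i s t : peq s t -> peq (i :: s) (i :: t).
Proof.
elim=> [u|{}s {}t u st _ IH]; first exact: PE_refl.
by apply: PE_step IH; apply: PS_cons.
Qed.

Lemma pstep_catr u s t : pstep s t -> pstep (s ++ u) (t ++ u).
Proof.
by elim=> *; [apply: PS_comm | apply: PS_braid | apply: PS_cons].
Qed.

Lemma peq_cat s t u v : peq s t -> peq u v -> peq (s ++ u) (t ++ v).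
Proof.
move=> st uv; apply: (@peq_trans _ (s ++ v)).
  by elim: s {st} => //= i s; apply: peq_cons.
elim: st => [w|{}s {}t w st _ IH]; first exact: PE_refl.
exact: PE_step (pstep_catr v st) IH.
Qed.

Global Instance peq_equivalence : Equivalence peq.
Proof.
split; [exact: PE_refl | exact: peq_sym | exact: peq_trans].
Qed.

Global Instance cons_proper i : Proper (peq ==> peq) (cons i).
Proof. exact: peq_cons. Qed.

Global Instance cat_proper : Proper (peq ==> peq ==> peq) cat.
Proof. by move=> s t st u v uv; apply: peq_cat. Qed.

Global Instance rcons_proper : Proper (peq ==> eq ==> peq) (@rcons 'I_k).
Proof. by move=> s t st i _ <-; rewrite -!cats1; apply: peq_cat (PE_refl _). Qed.

Lemma peq_comm i j t : far i j -> peq (i :: j :: t) (j :: i :: t).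
Proof. by move=> ij; apply: PE_step (PE_refl _); apply: PS_comm. Qed.

Lemma peq_braid i j t : adj i j -> peq (i :: j :: i :: t) (j :: i :: j :: t).
Proof. by move=> ij; apply: PE_step (PE_refl _); apply: PS_braid. Qed.

Lemma peq_size s t : peq s t -> size s = size t.
Proof.
have st s' t' : pstep s' t' -> size s' = size t' by elim=> //= *; lia.
by elim=> // ? ? ? /st -> _ ->.
Qed.

Lemma pstep_rcat u s t : pstep s t -> pstep (u ++ s) (u ++ t).
Proof. by elim: u => //= i u IH /IH; apply: PS_cons. Qed.

Lemma peq_rev s t : peq s t -> peq (rev s) (rev t).
Proof.
have rstep s' t' : pstep s' t' -> pstep (rev s') (rev t').
  elim=> [i j u ij|i j u ij|i u v _ IH].
  - rewrite !(rev_cons, =^~ cats1, =^~ catA) /=.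
    by apply: pstep_rcat; apply: PS_comm; rewrite farC.
  - rewrite !(rev_cons, =^~ cats1, =^~ catA) /=.
    by apply: pstep_rcat; apply: PS_braid.
  - by rewrite !rev_cons -!cats1; apply: pstep_catr.
elim=> [u|{}s {}t u /rstep st _]; [exact: PE_refl | exact: PE_step].
Qed.

(* [i :: compl i j] is the least common right multiple of [i] and [j]. *)
Definition compl i j : seq 'I_k :=
  if i == j then [::] else if adj i j then [:: j; i] else [:: j].

Lemma compl_far i j : far i j -> compl i j = [:: j].
Proof.
rewrite /compl /far /adj => ij; have -> : (i == j) = false.
  by apply/eqP => e; move: ij; rewrite e; lia.
by rewrite ifN //; lia.
Qed.

Lemma compl_adj i j : adj i j -> compl i j = [:: j; i].
Proof.
rewrite /compl => ij; have -> : (i == j) = false; last by rewrite ij.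
by apply/eqP => e; move: ij; rewrite /adj e; lia.
Qed.

Lemma compl_id i : compl i i = [::].
Proof. by rewrite /compl eqxx. Qed.

Variant dist_spec i j : Type :=
| DistEq of i = j
| DistAdj of adj i j
| DistFar of far i j.

Lemma distP i j : dist_spec i j.
Proof.
have [?|ij] := eqVneq i j; first exact: DistEq.
case: (boolP (adj i j)) => [|a]; first exact: DistAdj.
have {}ij : (i : nat) != j by [].
by apply: DistFar; rewrite /far; move: (negP a); rewrite /adj; lia.
Qed.

(** Any common right multiple of two letters is a multiple of their lcm. The case [i = j] is left
    cancellation. *)
Definition diamond u := forall i j v, peq (i :: u) (j :: v) ->
  exists w, peq u (compl i j ++ w) /\ peq v (compl j i ++ w).

Section Cube.
Variable L : nat.
Hypothesis IH : forall u, size u < L -> diamond u.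

(** This is transitivity of the diamond through a middle letter [h]: what follows [h] is a multiple
    of both complements, and a common multiple of [i] and [j] has to come out. The size bound makes
    [IH] available for the tails. *)
Definition cube i h j := forall u v, size (compl h i ++ u) <= L ->
  peq (compl h i ++ u) (compl h j ++ v) ->
  exists w, peq (compl i h ++ u) (compl i j ++ w) /\
            peq (compl j h ++ v) (compl j i ++ w).

Lemma cubeC i h j : cube i h j -> cube j h i.
Proof.
move=> C u v L1 e; have L2 := peq_size e.
by have [||w [? ?]] := C v u; [lia | exact: peq_sym | exists w].
Qed.

Lemma diamond_far i j u v : size u < L -> far i j ->
  peq (i :: u) (j :: v) -> exists w, peq u (j :: w) /\ peq v (i :: w).
Proof.
by move=> uL ij /(IH uL); rewrite !compl_far // farC.
Qed.

Lemma diamond_adj i j u v : size u < L -> adj i j ->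
  peq (i :: u) (j :: v) -> exists w, peq u (j :: i :: w) /\ peq v (i :: j :: w).
Proof.
by move=> uL ij /(IH uL); rewrite !compl_adj // adjC.
Qed.

Lemma diamond_cancel i u v : size u < L -> peq (i :: u) (i :: v) -> peq u v.
Proof.
by move=> uL /(IH uL) [w]; rewrite compl_id => -[-> ->].
Qed.

Lemma cube_far_far i h j : far i h -> far h j -> cube i h j.
Proof.
move=> ih hj u v; rewrite [compl h i]compl_far 1?farC // [compl h j]compl_far //.
rewrite [compl i h]compl_far // [compl j h]compl_far 1?farC //=.
move=> uL e; have [|w [uw vw]] := IH _ e; first by lia.
exists (h :: w); rewrite uw vw.
split; rewrite /compl; case: ifP => _ //=; case: ifP => _ /=.
- by rewrite peq_comm // (@peq_comm h i) // farC.
- by rewrite peq_comm.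
- by rewrite peq_comm 1?farC // (@peq_comm h j).
- by rewrite peq_comm // farC.
Qed.

(** If [j] is also adjacent to [i], the lcm of the three letters is the four-strand half twist
    [j i j h i j]; if not, [j] commutes with both other letters. *)
Lemma cube_adj_far i h j : adj i h -> far h j -> cube i h j.
Proof.
move=> ih hj u v; have hi := ih; rewrite adjC in hi.
have jh := hj; rewrite farC in jh.
rewrite (compl_adj ih) (compl_adj hi) (compl_far hj) (compl_far jh) /= => uL e.
have := peq_size e; rewrite /= => s0.
case: (distP i j) => [ij|ij|ij].
- by move: ih hj; rewrite /adj /far ij; lia.
- have ji := ij; rewrite adjC in ji.
  have [|z [e1 e2]] := diamond_adj _ ij e; first by rewrite /=; lia.
  have := peq_size e1; rewrite /= => s1.
  have [|y [e3 e4]] := diamond_far _ hj e1; first by lia.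
  have := peq_size e4; rewrite /= => s4.
  have [|x [e5 e6]] := diamond_adj _ ih e4; first by lia.
  exists (h :: i :: j :: x); rewrite (compl_adj ij) (compl_adj ji) /=; split.
    rewrite e3 e6 (@peq_braid i j) // (@peq_comm h j) //.
    by rewrite (@peq_comm j h x) // (@peq_braid h i).
  rewrite e2 e5 (@peq_comm j h) // (@peq_braid h i) //.
  by rewrite (@peq_braid i j) // (@peq_comm h j).
- have ji := ij; rewrite farC in ji.
  have [|z [e1 e2]] := diamond_far _ ij e; first by rewrite /=; lia.
  have := peq_size e1; rewrite /= => s1.
  have [|y [e3 e4]] := diamond_far _ hj e1; first by lia.
  exists (h :: i :: y); rewrite (compl_far ij) (compl_far ji) /=; split.
    by rewrite e3 (@peq_comm i j) // (@peq_comm h j).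
  by rewrite e2 e4 (@peq_braid h i).
Qed.

(** Two distinct neighbours of [h] commute. The three letters span a four-strand braid monoid, and
    the witness completes its half twist [i j h j i h]. *)
Lemma cube_adj_adj i h j : adj i h -> adj h j -> i != j -> cube i h j.
Proof.
move=> ih hj ij u v; have hi := ih; rewrite adjC in hi.
have jh := hj; rewrite adjC in jh.
have {}ij : far i j.
  case: (distP i j) => // [e|a]; first by rewrite e eqxx in ij.
  by move: ih hj a; rewrite /adj; lia.
have ji := ij; rewrite farC in ji.
rewrite (compl_adj ih) (compl_adj hi) (compl_adj hj) (compl_adj jh).
rewrite (compl_far ij) (compl_far ji) /= => uL e.
have := peq_size e; rewrite /= => s0.
have [|z [e1 e2]] := diamond_far _ ij e; first by rewrite /=; lia.
have := peq_size e1; have := peq_size e2; rewrite /= => s1 s2.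
have [|y [e3 e4]] := diamond_adj _ hj e1; first by lia.
have [|y' [e5 e6]] := diamond_adj _ hi e2; first by lia.
have := peq_size e4; rewrite /= => s4.
have e7 : peq (h :: j :: y) (h :: i :: y') by rewrite -e4 -e6.
have [||x [e8 e9]] := diamond_far _ ji (diamond_cancel _ e7).
- by rewrite /=; lia.
- by rewrite /=; lia.
exists (h :: j :: i :: h :: x); split.
  by rewrite e3 e8 (@peq_comm i j) // (@peq_braid i h) // (@peq_braid h j).
rewrite e5 e9 (@peq_comm j i) // (@peq_braid j h) // (@peq_braid h i) //.
by rewrite (@peq_comm i j).
Qed.

Lemma cube_id i h : cube i h i.
Proof.
move=> u v uL e; exists (compl i h ++ u); rewrite compl_id; split=> //=.
have cancel s : size (s ++ u) <= L -> peq (s ++ u) (s ++ v) -> peq u v.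
  elim: s => //= a s IHs sL es; apply: IHs; first by lia.
  exact: diamond_cancel es.
by rewrite (cancel _ uL e).
Qed.

Lemma cubeP i h j : cube i h j.
Proof.
have [<-|ij] := eqVneq i j; first exact: cube_id.
case: (distP i h) => [<-|ih|ih].
- by move=> u v _; rewrite compl_id /= => e; exists v; rewrite e.
- case: (distP h j) => [<-|hj|hj].
  + by move=> u v _; rewrite compl_id /= => e; exists u; rewrite e.
  + exact: cube_adj_adj.
  + exact: cube_adj_far.
- case: (distP h j) => [<-|hj|hj].
  + by move=> u v _; rewrite compl_id /= => e; exists u; rewrite e.
  + by apply: cubeC; apply: cube_adj_far; rewrite (adjC, farC).
  + exact: cube_far_far.
Qed.
End Cube.

(** In the second case a relation is applied at the head: the step passes from one side of the lcm
    of [i] and [h] to the other. *)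
Lemma pstep_head i s t : pstep (i :: s) t ->
  (exists2 s', t = i :: s' & peq s s') \/
  exists h r, s = compl i h ++ r /\ t = h :: compl h i ++ r.
Proof.
move Es : (i :: s) => s0 st.
case: st Es => {s0 t} [a b t ab|a b t ab|a s' t st] [-> ->].
- by right; exists b, t; rewrite !compl_far // farC.
- by right; exists b, t; rewrite !compl_adj // adjC.
- by left; exists t => //; apply: PE_step st (PE_refl _).
Qed.

(* Garside's lemma: the induction step is the cube condition on three letters. *)
Lemma diamondP u : diamond u.
Proof.
have [L] := ubnP (size u); elim: L u => // L IHL u; rewrite ltnS => uL i j v.
have IH : forall u, size u < L -> diamond u by [].
move Ex : (i :: u) => x; move Ey : (j :: v) => y e.
elim: e i u uL Ex j v Ey => {x y} [s|s t r st tr IHe] i u uL Ex j v Ey.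
  by move: Ey; rewrite -Ex => -[-> ->]; exists u; rewrite compl_id.
subst s r; case: (pstep_head st) => [[u' tE uu']|[h [r [uE tE]]]].
  have [|w [u'w vw]] := IHe i u' _ (esym tE) j v erefl.
    by rewrite -(peq_size uu').
  by exists w; rewrite uu'.
subst t u; have [|w [rw vw]] := IHe h _ _ erefl j v erefl.
  by have := peq_size (PE_step st (PE_refl _)) => -[<-].
have [|x [iw jw]] := cubeP IH _ rw.
  by have := peq_size (PE_step st (PE_refl _)) => -[<-].
by exists x; rewrite vw.
Qed.

Lemma peq_cancel_l s u v : peq (s ++ u) (s ++ v) -> peq u v.
Proof.
by elim: s => //= i s IHs /diamondP[w]; rewrite compl_id => -[/= sw sv];
   apply: IHs; rewrite sw sv.
Qed.

Lemma peq_cancel_r s u v : peq (u ++ s) (v ++ s) -> peq u v.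
Proof.
by move/peq_rev; rewrite !rev_cat => /peq_cancel_l/peq_rev; rewrite !revK.
Qed.

Lemma diamond_r i j u v : peq (rcons u i) (rcons v j) ->
  exists w, peq u (w ++ rev (compl i j)) /\ peq v (w ++ rev (compl j i)).
Proof.
move=> /peq_rev; rewrite !rev_rcons => /diamondP[w [/peq_rev uw /peq_rev vw]].
by exists (rev w); move: uw vw; rewrite !revK !rev_cat.
Qed.

End Monoid.

#[global] Hint Resolve PE_refl : core.

(** * The full twist as a central multiple of every generator *)

Section Delta.
Variable k : nat.
Implicit Types (i j : 'I_k.+1) (s t u v : seq 'I_k.+1).

Let gens m n : seq 'I_k.+1 := [seq inord a | a <- iota m n].

Let comm_gens i m n : (forall a, m <= a < m + n -> (i + 2 <= a) || (a + 2 <= i)) ->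
  m + n <= k.+1 -> peq (rcons (gens m n) i) (i :: gens m n).
Proof.
elim: n m => [//|n IHn] m Hf mk /=.
rewrite IHn; last by lia.
  by apply: peq_comm; rewrite farC /far inordK; [apply: Hf|]; lia.
by move=> a ma; apply: Hf; lia.
Qed.

Definition delta : seq 'I_k.+1 := gens 0 k.+1.

Lemma delta_shift a : a < k ->
  peq (rcons delta (inord a)) (inord a.+1 :: delta).
Proof.
move=> ak.
have -> : delta = gens 0 a ++ [:: inord a, inord a.+1 & gens a.+2 (k.+1 - a.+2)].
  have -> : delta = gens 0 (a + (2 + (k.+1 - a.+2))) by congr gens; lia.
  by rewrite /gens iotaD map_cat.
rewrite -cats1 -!catA !cat_cons cats1.
rewrite comm_gens; [|by move=> b; rewrite inordK; lia|by lia].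
rewrite peq_braid; last by rewrite /adj !inordK; lia.
rewrite -cat_rcons.
by rewrite (@comm_gens (inord a.+1)); [|by move=> b; rewrite inordK; lia|by lia].
Qed.

(** Moving the first factor across all letters of the second but the last raises their indices by
    one; the letter [inord 0] put in front then completes a new [delta]. This is how conjugation by
    [delta] wraps around the indices. *)
Lemma delta_square : peq (inord 0 :: delta ++ delta) (rcons (delta ++ delta) (inord k)).
Proof.
have shift n : n <= k -> peq (delta ++ gens 0 n) (gens 1 n ++ delta).
  elim: n => [|n IHn] nk; first by rewrite cats0.
  have -> : gens 0 n.+1 = rcons (gens 0 n) (inord n).
    by rewrite /gens -[X in iota _ X]addn1 iotaD map_cat -cats1.
  have -> : gens 1 n.+1 = rcons (gens 1 n) (inord n.+1).
    by rewrite /gens -[X in iota _ X]addn1 iotaD map_cat -cats1.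
  rewrite -rcons_cat -cats1 IHn; last by lia.
  by rewrite -catA cats1 delta_shift // cat_rcons.
have E : delta = rcons (gens 0 k) (inord k).
  by rewrite /delta /gens -[X in iota _ X]addn1 iotaD map_cat -cats1.
have D2 : peq (delta ++ delta) (gens 1 k ++ rcons delta (inord k)).
  by rewrite {2}E -rcons_cat -cats1 shift // -catA cats1.
by rewrite rcons_cat; apply: peq_trans (peq_cons (inord 0) D2) (PE_refl _).
Qed.

Definition delta_pow m : seq 'I_k.+1 := flatten (nseq m delta).

Lemma delta_powD m p : delta_pow (m + p) = delta_pow m ++ delta_pow p.
Proof. by rewrite /delta_pow nseqD flatten_cat. Qed.

Lemma delta_pow_shift a m : a + m <= k ->
  peq (delta_pow m ++ [:: inord a]) (inord (a + m) :: delta_pow m).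
Proof.
elim: m => [|m IHm] am; first by rewrite addn0.
have -> : delta_pow m.+1 = delta ++ delta_pow m by [].
rewrite -catA IHm; last by lia.
by rewrite -cat_rcons delta_shift ?addnS //; lia.
Qed.

(** With [k.+1] generators there are [k.+2] strands, and this power of [delta] is the full twist. *)
Definition garside : seq 'I_k.+1 := delta_pow k.+2.

(** For the letter 0, two factors carry it to the letter [k] and the other [k] factors carry that
    back to 0. The letter [i] is the conjugate of the letter 0 by [delta_pow i], which commutes with
    [garside]. *)
Lemma garside_comm_letter i : peq (i :: garside) (garside ++ [:: i]).
Proof.
have comm0 : peq (inord 0 :: garside) (garside ++ [:: inord 0]).
  have -> : garside = (delta ++ delta) ++ delta_pow k by rewrite -catA.
  rewrite -[X in peq _ X]catA delta_pow_shift ?add0n //.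
  by rewrite -cat_cons delta_square cat_rcons.
have shift0 := @delta_pow_shift 0 i (ltn_ord i); rewrite add0n inord_val in shift0.
apply: (@peq_cancel_r _ (delta_pow i)).
have GD : garside ++ delta_pow i = delta_pow i ++ garside.
  by rewrite /garside -!delta_powD addnC.
rewrite cat_cons GD -catA cat1s -shift0 catA GD -catA -comm0.
by rewrite -(cat1s (inord 0) garside) catA shift0.
Qed.

Lemma garside_comm u : peq (u ++ garside) (garside ++ u).
Proof.
elim: u => [|i u IHu]; first by rewrite cats0.
by rewrite cat_cons IHu -cat_cons garside_comm_letter -catA.
Qed.

(** [delta] begins with the letter 0, so [delta_pow i ++ delta] can be rewritten to begin with [i].
    Centrality makes the same quotient work on the right. *)
Lemma garside_div i : exists p, peq (i :: p) garside /\ peq (rcons p i) garside.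
Proof.
have [p ip] : exists p, peq (i :: p) garside.
  have shift0 := @delta_pow_shift 0 i (ltn_ord i); rewrite add0n inord_val in shift0.
  exists (delta_pow i ++ behead delta ++ delta_pow (k.+1 - i)).
  rewrite -cat_cons -shift0 -catA.
  have -> : garside = delta_pow i ++ delta ++ delta_pow (k.+1 - i).
    have E : k.+2 = i + (1 + (k.+1 - i)) by have := ltn_ord i; lia.
    by rewrite /garside E !delta_powD {2}/delta_pow /= cats0.
  exact: PE_refl.
exists p; split=> //; apply: (@peq_cancel_l _ [:: i]).
by rewrite /= -rcons_cons -cats1 ip garside_comm_letter.
Qed.
End Delta.

(** * Positive braids inside the group and finite regions of the Cayley graph *)

Section Region.
Local Open Scope group_scope.
Variable n : nat.
Notation I := ('I_n.-1).
Implicit Types (i j : I) (u v : seq I) (w : braid_word n) (g p q : braid n).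

Definition pos u : braid_word n := [seq (i, true) | i <- u].
Definition gen i (b : bool) : braid n := braid_of [:: (i, b)].
Definition posb u : braid n := braid_of (pos u).
Definition positive g := exists u, g = posb u.

Lemma gen_inv i b : (gen i b)^-1 = gen i (~~ b).
Proof. by rewrite /gen -braid_of_inv. Qed.

Lemma genK i b : gen i b * gen i (~~ b) = 1.
Proof. by rewrite -gen_inv mulgV. Qed.

Lemma genVK i b : gen i (~~ b) * gen i b = 1.
Proof. by rewrite -gen_inv mulVg. Qed.

Lemma braid_of_cons a w : braid_of (a :: w) = gen a.1 a.2 * braid_of w.
Proof. by rewrite -cat1s braid_of_cat; case: a. Qed.

Lemma posb_cat u v : posb (u ++ v) = posb u * posb v.
Proof. by rewrite /posb /pos map_cat braid_of_cat. Qed.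

Lemma posb1 i : posb [:: i] = gen i true.
Proof. by []. Qed.

Lemma peq_posb u v : peq u v -> posb u = posb v.
Proof.
elim=> // {}u {}v t st _ <-; elim: st => {u v t} [i j t ij|i j t ij|i u v _ IH].
- rewrite -[_ :: _]/([:: i; j] ++ t) -[RHS]/(posb ([:: j; i] ++ t)) !posb_cat.
  by congr (_ * _); apply/braid_ofP/BE_comm.
- rewrite -[_ :: _]/([:: i; j; i] ++ t) -[RHS]/(posb ([:: j; i; j] ++ t)).
  by rewrite !posb_cat; congr (_ * _); apply/braid_ofP/BE_braid.
- by rewrite -cat1s -(cat1s i v) !posb_cat IH.
Qed.

Lemma garside_exists : exists D : seq I,
  (forall u, peq (u ++ D) (D ++ u)) /\
  exists co : I -> seq I,
    forall i, peq (i :: co i) D /\ peq (rcons (co i) i) D.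
Proof.
(* Without generators the empty word serves as [D]; the full twist needs at least one generator. *)
case: (n.-1) => [|k].
  by exists [::]; split=> [u|]; [rewrite cats0 | exists (fun _ => [::]) => -[]].
exists (garside k); split; first exact: garside_comm.
by have [co coP] := choice (@garside_div k); exists co.
Qed.

Section Embedding.
Variables (D : seq I) (co : I -> seq I).
Hypothesis DC : forall u, peq (u ++ D) (D ++ u).
Hypothesis coP : forall i, peq (i :: co i) D /\ peq (rcons (co i) i) D.

(** This clears denominators: [co i] is the inverse of [i] times the central [D], so [plus w] is [w]
    times one [D] for each negative letter. *)
Definition plus w := flatten [seq if a.2 then [:: a.1] else co a.1 | a <- w].
Definition negs w := count (fun a : letter n => ~~ a.2) w.
Definition Dpow m := flatten (nseq m D).

Let DpowC m u : peq (u ++ Dpow m) (Dpow m ++ u).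
Proof.
elim: m => [|m IHm]; first by rewrite cats0.
rewrite -[Dpow m.+1]/(D ++ Dpow m) catA DC -catA IHm.
by rewrite catA.
Qed.

Let DpowD a b : Dpow (a + b) = Dpow a ++ Dpow b.
Proof. by rewrite /Dpow nseqD flatten_cat. Qed.

(** Both words are read as fractions with powers of [D] as denominators, and each relation preserves
    the cross-multiplied equality; transitivity uses cancellation. On positive words the
    denominators vanish, so the monoid embeds in the group. *)
Lemma braid_equiv_plus w w' : braid_equiv w w' ->
  peq (plus w ++ Dpow (negs w')) (plus w' ++ Dpow (negs w)).
Proof.
have plus_cat s t : plus (s ++ t) = plus s ++ plus t.
  by rewrite /plus map_cat flatten_cat.
have negs_cat s t : negs (s ++ t) = (negs s + negs t)%N by exact: count_cat.
elim=> {w w'}.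
- move=> i []; rewrite /plus /negs /Dpow /= !cats0; first by case: (coP i).
  by rewrite cats1; case: (coP i).
- by move=> i j ij; apply: peq_comm.
- by move=> i j ij; apply: peq_braid.
- move=> s t u v _ IH; rewrite !plus_cat !negs_cat.
  have E a : Dpow (negs s + (a + negs t)) = Dpow a ++ Dpow (negs s + negs t).
    by rewrite -DpowD; congr Dpow; lia.
  have F a r : peq (plus t ++ Dpow a ++ r) (Dpow a ++ plus t ++ r).
    by rewrite catA DpowC -catA.
  by rewrite !E -!catA !F (catA (plus u)) IH -!catA.
- by [].
- by move=> u v _ ->.
- move=> u v w _ IH1 _ IH2.
  apply: (@peq_cancel_r _ (Dpow (negs v))).
  rewrite -catA -DpowD addnC DpowD catA IH1 -catA -DpowD addnC DpowD catA IH2.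
  by rewrite -!catA -!DpowD addnC.
Qed.

Lemma posb_peq u v : posb u = posb v -> peq u v.
Proof.
have E t : plus (pos t) = t by elim: t => //= i t {2}<-.
have N t : negs (pos t) = 0 by elim: t.
by move=> /braid_ofP/braid_equiv_plus; rewrite !E !N !cats0.
Qed.

Lemma posb_D_comm g : commute (posb D) g.
Proof.
rewrite -(braid_of_repr g); elim: (repr g) => [|[i b] w IHw].
  exact: commute1.
rewrite braid_of_cons; apply: commuteM => //=.
have ci : commute (posb D) (gen i true).
  by rewrite /commute -posb1 -!posb_cat; apply: peq_posb; rewrite DC.
by case: b => //; rewrite -(gen_inv i true); apply: commuteV.
Qed.

Lemma braid_of_plus w : braid_of w * posb D ^+ negs w = posb (plus w).
Proof.
elim: w => [|[i b] w IHw]; first by rewrite expg0 mulg1.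
rewrite braid_of_cons -[plus _]/((if b then [:: i] else co i) ++ plus w).
rewrite posb_cat -IHw /=; case: b => /=; first by rewrite mulgA.
rewrite add1n expgS -(mulgA (gen i false)) (mulgA (braid_of w) (posb D)) -posb_D_comm.
rewrite !mulgA; congr (_ * _ * _).
rewrite -(peq_posb (proj1 (coP i))) -cat1s posb_cat posb1 mulgA.
by rewrite (genK i false) mul1g.
Qed.

Lemma positive_mul g q : positive g -> positive q -> positive (g * q).
Proof. by move=> [u ->] [v ->]; exists (u ++ v); rewrite posb_cat. Qed.

Lemma positive_gen i : positive (gen i true).
Proof. by exists [:: i]. Qed.

Lemma positive_pow m : positive (posb D ^+ m).
Proof.
elim: m => [|m IHm]; first by exists [::].
by rewrite expgS; apply: positive_mul => //; exists D.
Qed.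

Lemma positive_shift w m : negs w <= m -> positive (posb D ^+ m * braid_of w).
Proof.
move=> wm; rewrite -(subnK wm) expgnDr -mulgA.
rewrite -(commuteX _ (commute_sym (posb_D_comm (braid_of w)))) braid_of_plus.
by apply: positive_mul; [apply: positive_pow | exists (plus w)].
Qed.

(** Here [q] is divisible on the right by both letters, hence by their lcm. *)
Lemma positive_lcm_r q i j :
  positive (q * gen i false) -> positive (q * gen j false) ->
  exists2 g, positive g & q * gen i false = g * posb (rev (compl i j)).
Proof.
move=> [u uE] [v vE].
have E : posb (rcons u i) = posb (rcons v j).
  rewrite -!cats1 !posb_cat !posb1 -uE -vE -!mulgA.
  by rewrite (genK i false) (genK j false).
have [w [uw vw]] := diamond_r (posb_peq E).
by exists (posb w); [exists w | rewrite uE (peq_posb uw) posb_cat].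
Qed.

Lemma positive_lcm_l q i j :
  positive (gen i false * q) -> positive (gen j false * q) ->
  exists2 g, positive g & gen i false * q = posb (compl i j) * g.
Proof.
move=> [u uE] [v vE].
have E : posb (i :: u) = posb (j :: v).
  rewrite -cat1s -(cat1s j) !posb_cat !posb1 -uE -vE !mulgA.
  by rewrite (genK i true) (genK j true).
have [w [uw vw]] := diamondP (posb_peq E).
by exists (posb w); [exists w | rewrite uE (peq_posb uw) posb_cat].
Qed.

Definition between d g := positive g /\ positive (g^-1 * posb D ^+ d).
End Embedding.

(* A set of vertices of the Cayley graph that contains, along with two edges of
   the same direction at a vertex, the whole relation polygon they span. *)
Record closed_region (X : braid n -> Prop) : Prop := ClosedRegion {
  region_far : forall q i j b, far i j ->
    X q -> X (q * gen i b) -> X (q * gen j b) -> X (q * gen i b * gen j b);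
  region_adj : forall q i j b, adj i j ->
    X q -> X (q * gen i b) -> X (q * gen j b) ->
    X (q * gen i b * gen j b) /\ X (q * gen i b * gen j b * gen i b);
  region_convex : forall q i j b,
    X q -> X (q * gen i b * gen j b) -> X (q * gen i b)
}.

Section Between.
Variables (D : seq I) (co : I -> seq I).
Hypothesis DC : forall u, peq (u ++ D) (D ++ u).
Hypothesis coP : forall i, peq (i :: co i) D /\ peq (rcons (co i) i) D.

Lemma betweenM d g i b :
  between D d (g * gen i b) <->
  positive (g * gen i b) /\ positive (gen i (~~ b) * (g^-1 * posb D ^+ d)).
Proof. by rewrite /between invgM gen_inv mulgA. Qed.

Lemma betweenMM d g i j b b' :
  between D d (g * gen i b * gen j b') <->
  positive (g * gen i b * gen j b') /\
  positive (gen j (~~ b') * (gen i (~~ b) * (g^-1 * posb D ^+ d))).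
Proof. by rewrite betweenM invgM gen_inv -(mulgA _ g^-1). Qed.

(** Along positive edges, positivity of the vertex is clear, and the cofactor [q^-1 D^d] is
    divisible on the left by both letters, hence by their lcm. Along negative edges the vertex and
    the cofactor exchange roles. *)
Lemma between_closed d : closed_region (between D d).
Proof.
have pg := positive_gen; have pm := positive_mul.
split.
- move=> q i j [] ij [q1 q2]; rewrite betweenMM !betweenM => -[i1 i2] [j1 j2].
    split; first exact: pm.
    have [g gp ->] := positive_lcm_l DC coP i2 j2.
    by rewrite compl_far // posb1 mulgA (genK j false) mul1g.
  split; last exact: pm.
  have [g gp ->] := positive_lcm_r DC coP i1 j1.
  by rewrite compl_far // posb1 -mulgA (genK j true) mulg1.
- move=> q i j b ij [q1 q2]; rewrite !betweenMM !betweenM => -[i1 i2] [j1 j2].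
  have D0 := compl_adj ij; case: b i1 i2 j1 j2 => i1 i2 j1 j2.
    have [g gp gE] := positive_lcm_l DC coP i2 j2.
    have g1 : gen j false * (gen i false * (q^-1 * posb D ^+ d)) = gen i true * g.
      rewrite gE D0 (posb_cat [:: j]) !posb1 -mulgA [LHS]mulgA.
      by rewrite (genK j false) mul1g.
    rewrite invgM gen_inv -(mulgA _ q^-1) g1.
    by split; split; rewrite ?[gen i _ * (gen i _ * _)]mulgA ?(genK i false) ?mul1g;
       auto.
  have [g gp gE] := positive_lcm_r DC coP i1 j1.
  have g1 : q * gen i false * gen j false = g * gen i true.
    by rewrite gE D0 (posb_cat [:: i]) !posb1 -!mulgA (genK j true) mulg1.
  rewrite g1 invgM gen_inv -(mulgA _ q^-1).
  by split; split; rewrite -?(mulgA g) ?(genK i true) ?mulg1; auto.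
- move=> q i j [] [q1 q2]; rewrite betweenMM betweenM => -[p1 p2].
    split; first exact: pm.
    by have := pm _ _ (pg j) p2; rewrite [_ * (gen j _ * _)]mulgA (genK j true) mul1g.
  split; last exact: pm.
  by have := pm _ _ p1 (pg j); rewrite -(mulgA _ (gen j _)) (genK j false) mulg1.
Qed.

(** The relations preserve length, so a positive divisor is spelled by a word no longer than
    [Dpow D d]. *)
Lemma between_finite d : exists l : seq (braid n), forall g, between D d g -> g \in l.
Proof.
pose N := size (Dpow D d).
exists (flatten [seq [seq posb (val t) | t <- enum {: m.-tuple I}] | m <- iota 0 N.+1]).
move=> g [[u ->] [v vE]]; apply/flattenP.
exists [seq posb (val t) | t <- enum {: (size u).-tuple I}].
  apply/mapP; exists (size u) => //; rewrite mem_iota add0n ltnS /=.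
  have : posb (u ++ v) = posb (Dpow D d).
    rewrite posb_cat -vE mulVKg /Dpow; elim: d {N vE} => // d IHd.
    by rewrite expgS IHd -posb_cat.
  by move/(posb_peq DC coP)/peq_size; rewrite /N => <-; rewrite size_cat leq_addr.
by apply/mapP; exists (in_tuple u); rewrite ?mem_enum.
Qed.
End Between.

Lemma braid_region (w : braid_word n) :
  exists (X : braid n -> Prop) (l : seq (braid n)) (p : braid n),
  [/\ closed_region X, forall g, X g -> g \in l &
      forall u v : braid_word n, w = u ++ v -> X (p * braid_of u)].
Proof.
have [D [DC [co coP]]] := garside_exists.
(* One half of the exponent makes the prefixes of [w] positive, the other half their cofactors: a
   prefix and its inverse each have at most [size w] negative letters. *)
have [l lP] := between_finite DC coP (size w + size w).
exists (between D (size w + size w)), l, (posb D ^+ size w); split=> //.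
  exact: between_closed DC coP _.
move=> u v wE; split; first apply: (positive_shift DC coP).
  by rewrite wE size_cat (leq_trans (count_size _ _)) ?leq_addr.
rewrite invgM -mulgA expgnDr mulKg -braid_of_inv.
rewrite (commuteX _ (commute_sym (posb_D_comm DC _))).
apply: (positive_shift DC coP).
rewrite (leq_trans (count_size _ _)) // size_rev size_map wE size_cat leq_addr //.
Qed.
End Region.

(** * Every braid is trivial, sigma-positive or sigma-negative *)

Section Comparison.
Local Open Scope group_scope.
Variable n : nat.
Notation I := ('I_n.-1).
Implicit Types (i j : I) (w u v : braid_word n) (g p q : braid n).

Lemma gen_comm i j b c : far i j -> gen i b * gen j c = gen j c * gen i b.
Proof.
move=> ij; have C : commute (gen i true) (gen j true).
  by rewrite /commute /gen -!braid_of_cat; apply/braid_ofP; apply: BE_comm.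
have C1 : commute (gen i b) (gen j true).
  case: b => //; rewrite -(gen_inv i true).
  by apply/commute_sym/commuteV/commute_sym.
by case: c => //; rewrite -(gen_inv j true); apply: commuteV.
Qed.

Lemma gen_braid i j b : adj i j ->
  gen i b * gen j b * gen i b = gen j b * gen i b * gen j b.
Proof.
move=> ij; have B : gen i true * gen j true * gen i true
                  = gen j true * gen i true * gen j true.
  by rewrite /gen -!braid_of_cat; apply/braid_ofP; apply: BE_braid.
case: b => //; apply: (@invg_inj (braid n)).
by rewrite !invgM !gen_inv !mulgA.
Qed.

Lemma gen_slide i j b : adj i j ->
  gen i b * gen j (~~ b) * gen i (~~ b) = gen j (~~ b) * gen i (~~ b) * gen j b.
Proof.
move=> ij; rewrite -!gen_inv; set s := gen i b; set t := gen j b.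
have E : t = t * s * t * t^-1 * s^-1 by rewrite !mulgK.
rewrite [X in _ = _ * X]E -gen_braid // !mulgA.
by rewrite mulgVK mulVg mul1g.
Qed.

Fixpoint inside (X : braid n -> Prop) p w : Prop :=
  X p /\ if w is a :: w' then inside X (p * gen a.1 a.2) w' else True.

(** Comparing successors makes the condition vacuous for [m = 0], where there is no generator
    below. *)
Definition semidef_below (m : nat) e w :=
  all (fun a : letter n => (a.1.+1 == m) ==> (a.2 == e)) w.

Section Inside.
Variable X : braid n -> Prop.
Hypothesis HX : closed_region X.

Lemma inside_start p w : inside X p w -> X p.
Proof. by case: w => [|? ?] []. Qed.

Lemma inside_cat p u v :
  inside X p (u ++ v) <-> inside X p u /\ inside X (p * braid_of u) v.
Proof.
elim: u p => [|a u IHu] p /=.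
  by rewrite mulg1; split=> [h|[_ h]] //; split=> //; split=> //; apply: inside_start h.
by rewrite braid_of_cons mulgA IHu; tauto.
Qed.

Lemma inside_end p w : inside X p w -> X (p * braid_of w).
Proof. by rewrite -{1}(cats0 w) inside_cat => -[_] []. Qed.

Lemma inside_inv p w : inside X p w -> inside X (p * braid_of w) (inv_word w).
Proof.
elim: w p => [|[i b] w IHw] p /= [Xp pw]; first by split=> //; rewrite mulg1.
rewrite -cat1s inv_word_cat inside_cat braid_of_cat mulgA; split; first exact: IHw.
rewrite braid_of_inv mulgK /=; split; first exact: inside_start pw.
by rewrite -mulgA genK mulg1.
Qed.

(* Pushed to the right across [s_j^-b] with [j = i - 1], the letter [s_i^b]
   leaves [s_j^-b s_i^-b s_j^b] on its left. *)
Lemma push_right p i b v :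
    inside X p ((i, b) :: v) -> low i v -> semidef_below i (~~ b) v ->
  exists u, [/\ inside X p (rcons u (i, b)),
                braid_of (rcons u (i, b)) = braid_of ((i, b) :: v),
                low i.+1 u & semidef i (~~ b) u].
Proof.
elim: v p => [|[j c] v IHv] p; first by move=> h _ _; exists [::].
move=> /= [Xp [Xs Xv]] /andP[ji lv] /andP[sj sv].
have Xa := inside_start Xv.
have jNi : (j == i :> nat) = false by move: ji; rewrite /=; lia.
have [adj_ij|far_ij] : adj i j \/ far i j by rewrite /adj /far; lia.
- move: sj; rewrite (_ : j.+1 == i :> nat) /=; last by move: adj_ij ji; rewrite /adj; lia.
  move/eqP => cE; subst c.
  have ps : p * gen i b * gen i (~~ b) = p by rewrite -mulgA genK mulg1.
  have XP : X (p * gen i b * gen i (~~ b)) by rewrite ps.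
  have [X1 X2] := region_adj HX adj_ij Xs XP Xa; rewrite ps in X1 X2.
  have adj_ji := adj_ij; rewrite adjC in adj_ji.
  have [X3 _] := region_adj HX adj_ji Xs Xa XP.
  have sl := gen_slide b adj_ij.
  have E : p * gen j (~~ b) * gen i (~~ b) * gen j b
         = p * gen i b * gen j (~~ b) * gen i (~~ b).
    by rewrite -!mulgA !(mulgA (gen _ _)) -sl.
  have E' : p * gen j (~~ b) * gen i (~~ b) * gen j b * gen i b
          = p * gen i b * gen j (~~ b).
    by rewrite E -mulgA genVK mulg1.
  have [||| u [pu uE lu su]] := IHv (p * gen j (~~ b) * gen i (~~ b) * gen j b).
  + by split; [rewrite E | rewrite E'].
  + exact: lv.
  + exact: sv.
  exists ([:: (j, ~~ b); (i, ~~ b); (j, b)] ++ u); split.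
  + rewrite rcons_cat inside_cat !braid_of_cons /= !mulg1 !mulgA.
    by do !split=> //; apply: inside_start pu.
  + rewrite rcons_cat braid_of_cat uE !braid_of_cons /= !mulgA.
    by congr (_ * _); rewrite mulg1 -sl -mulgA genVK mulg1.
  + by rewrite /low /= -/(low i.+1 u) lu; move: ji; rewrite /=; lia.
  + by rewrite /semidef /= -/(semidef i (~~ b) u) su jNi !eqxx.
(* The fourth vertex of a commutation square: for equal signs it lies between two vertices of [X],
   for opposite signs the square is spanned by two edges at [p * gen i b]. *)
have Xpa : X (p * gen j c).
  have [cb|cb] := eqVneq c b.
    subst c; apply: (region_convex HX (j := i) (b := b)) => //.
    by rewrite -mulgA gen_comm ?mulgA // farC.
  have cE : c = ~~ b by move: cb; case: (c); case: (b).
  subst c; have ps : p * gen i b * gen i (~~ b) = p by rewrite -mulgA genK mulg1.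
  have XP : X (p * gen i b * gen i (~~ b)) by rewrite ps.
  by have := region_far HX far_ij Xs XP Xa; rewrite ps.
have E : p * gen j c * gen i b = p * gen i b * gen j c.
  by rewrite -!mulgA gen_comm // farC.
have [||| u [pu uE lu su]] := IHv (p * gen j c).
+ by split; rewrite ?E.
+ exact: lv.
+ exact: sv.
exists ((j, c) :: u); split.
+ by [].
+ by rewrite rcons_cons braid_of_cons uE !braid_of_cons /= !mulgA gen_comm // farC.
+ by rewrite /low /= -/(low i.+1 u) lu andbT; apply: ltnW.
+ by rewrite /semidef /= -/(semidef i (~~ b) u) su jNi.
Qed.

(** If [e] is opposite to [b], the first letter is pushed right until it cancels the last one.
    Otherwise the same is done on the path read backwards. The remaining letters of index [i] have
    sign [e] in both cases. *)
Lemma handle p i b e v :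
    inside X p ((i, b) :: rcons v (i, ~~ b)) -> low i v -> semidef_below i e v ->
  exists u, [/\ inside X p u, braid_of u = braid_of ((i, b) :: rcons v (i, ~~ b)),
                low i.+1 u & semidef i e u].
Proof.
have [eb|eb] := boolP (e == ~~ b); last first.
  have {eb} -> : e = b by move: eb; case: (e); case: (b).
  move=> /inside_inv; set q := _ * _; set w := (_ :: _) => qw lv sv.
  have wE : inv_word w = (i, b) :: rcons (inv_word v) (i, ~~ b).
    by rewrite /w -cat1s -cats1 !inv_word_cat /= negbK cats1.
  rewrite wE -rcons_cons -cats1 in qw.
  have [||| u [qu uE lu su]] := @push_right q i b (inv_word v).
  - by move/inside_cat: qw => [].
  - by rewrite /low /inv_word all_rev all_map.
  - rewrite /semidef_below /inv_word all_rev all_map; apply: sub_all sv => a /=.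
    by case: a.2; case: (b).
  rewrite -cats1 in qu uE; move/inside_cat: qu => [/inside_inv qu _].
  have uE' : braid_of u = (braid_of w)^-1.
    rewrite -braid_of_inv wE -rcons_cons -cats1 braid_of_cat -uE braid_of_cat -mulgA.
    by rewrite -[braid_of [:: (i, b)]]/(gen i b) (genK i b) mulg1.
  exists (inv_word u); split.
  - by rewrite uE' /q mulgK in qu.
  - by rewrite braid_of_inv uE' invgK.
  - by rewrite /low /inv_word all_rev all_map.
  - rewrite /semidef /inv_word all_rev all_map; apply: sub_all su => a /=.
    by case: a.2; case: (b).
move/eqP: eb => -> pw lv sv.
rewrite -rcons_cons -cats1 in pw *.
have [||| u [pu uE lu su]] := @push_right p i b v.
- by move/inside_cat: pw => [].
- by [].
- by [].
exists u; split=> //.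
  by move: pu; rewrite -cats1 => /inside_cat[].
rewrite braid_of_cat -uE -cats1 braid_of_cat -mulgA.
by rewrite -[braid_of [:: (i, b)]]/(gen i b) (genK i b) mulg1.
Qed.

Section Rank.
Variables (l : seq (braid n)) (m : nat) (b : bool).
Hypothesis Xl : forall g, X g -> g \in l.

Definition before p q : Prop := exists w,
  [/\ low m.+1 w, semidef m b w, occurs m w & q = p * braid_of w].

(** A height on the finite region: constant along letters below [m], strictly increasing along edges
    of index [m] and sign [b]. *)
Definition rank q := count (fun p => `[< before p q >]) l.

Lemma semidef_low c w : low m w -> semidef m c w.
Proof. by apply: sub_all => a am; apply/implyP => /eqP; lia. Qed.

Lemma low_S w : low m w -> low m.+1 w.
Proof. by apply: sub_all => a /ltnW. Qed.

Lemma before_low p q w : low m w -> before p q -> before p (q * braid_of w).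
Proof.
move=> lw [u [lu su ou ->]]; exists (u ++ w); split.
- by rewrite /low all_cat -!/(low _ _) lu low_S.
- by rewrite /semidef all_cat -!/(semidef _ _ _) su semidef_low.
- by rewrite /occurs has_cat -!/(occurs _ _) ou.
- by rewrite braid_of_cat mulgA.
Qed.

Lemma rank_low q w : low m w -> rank (q * braid_of w) = rank q.
Proof.
move=> lw; apply: eq_count => p; apply: asbool_equiv_eq; split; last exact: before_low.
move/(@before_low _ _ (inv_word w)); rewrite braid_of_inv mulgK; apply.
by rewrite /low /inv_word all_rev all_map.
Qed.

(** The vertex [q] itself is newly counted at the end of the edge: it is not before itself, since a
    definite word is nontrivial. *)
Lemma rank_gen q (a : letter n) : X q -> a.1 = m :> nat -> a.2 = b ->
  rank q < rank (q * gen a.1 a.2).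
Proof.
move=> Xq am ab.
have qa : before q (q * gen a.1 a.2).
  exists [:: a]; rewrite /low /semidef /occurs /= am ab !eqxx !ltnSn; split=> //.
  by rewrite braid_of_cons mulg1 ab.
have sub p : `[< before p q >] ==> `[< before p (q * gen a.1 a.2) >].
  apply/implyP => /asboolP[w [lw sw ow ->]]; apply/asboolP; exists (rcons w a).
  rewrite /low /semidef /occurs all_rcons all_rcons has_rcons am ab !eqxx ltnSn.
  by split=> //; rewrite -cats1 braid_of_cat mulgA braid_of_cons mulg1 ab.
have irr : ~ before q q.
  move=> [w [lw sw ow e]]; apply: (@semidef_nontrivial n m b [::] w) => //.
  by apply/braid_ofP; apply: (@mulgI (braid n) q); rewrite -e mulg1.
move: (Xl Xq); rewrite /rank; elim: l => //= p l' IHl; rewrite inE => /orP[/eqP <-|ql].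
  rewrite (asboolF irr) (asboolT qa) add0n add1n ltnS.
  by apply: sub_count => p' /=; apply/implyP/sub.
by rewrite -addnS leq_add ?IHl //; case: asboolP (sub p) => //= _ ->.
Qed.

(** Powers of 2 let a single edge outweigh a whole semidefinite path of edges ending strictly below
    it. *)
Fixpoint weight p w : nat :=
  if w is a :: w' then
    (if a.1 == m :> nat then (2 ^ rank (p * gen a.1 a.2)%g)%N else 0)
    + weight (p * gen a.1 a.2) w'
  else 0.

Lemma weight_cat p u v : weight p (u ++ v) = weight p u + weight (p * braid_of u) v.
Proof.
elim: u p => [|a u IHu] p /=; first by rewrite mulg1.
by rewrite IHu braid_of_cons mulgA addnA.
Qed.

Lemma weight_low p w : low m w -> weight p w = 0.
Proof.
elim: w p => //= a w IHw p /andP[am lw]; rewrite IHw // addn0 ifN //; lia.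
Qed.

(* The ranks at the ends of the [m]-edges of a semidefinite path are strictly
   increasing. *)
Lemma weight_bound p w : inside X p w -> low m.+1 w -> semidef m b w ->
  weight p w + (2 ^ (rank p).+1)%N <= (2 ^ (rank (p * braid_of w)%g).+1)%N.
Proof.
elim: w p => [|a w IHw] p /=; first by rewrite mulg1.
move=> [Xp pw] /andP[am lw] /andP[sa sw].
have := IHw _ pw lw sw; rewrite braid_of_cons mulgA.
case: eqP sa => [a_m /= /eqP ab|a_m _].
  have := rank_gen Xp a_m ab => lt_r.
  have := leq_pexp2l (isT : 0 < 2) lt_r; rewrite !expnS; lia.
have -> : gen a.1 a.2 = braid_of [:: a] by rewrite braid_of_cons mulg1.
by rewrite rank_low ?add0n //= /low /= andbT; lia.
Qed.

End Rank.

Lemma split_first m w : occurs m w ->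
  exists u a v, [/\ w = u ++ a :: v, a.1 = m :> nat & ~~ occurs m u].
Proof.
elim: w => //= a w IHw; case: eqP => [am _|am /= /IHw[u [c [v [-> cm um]]]]].
  by exists [::], a, w.
by exists (a :: u), c, v; split=> //=; rewrite negb_or um andbT; apply/eqP.
Qed.

Lemma split_last m w : occurs m w ->
  exists u a v, [/\ w = u ++ a :: v, a.1 = m :> nat & ~~ occurs m v].
Proof.
elim: w => //= a w IHw; have [/IHw[u [c [v [-> cm vm]]]] _|wm] := boolP (occurs m w).
  by exists (a :: u), c, v.
by rewrite orbF => /eqP am; exists [::], a, w.
Qed.

Lemma not_occurs_low m w : low m.+1 w -> ~~ occurs m w -> low m w.
Proof.
elim: w => //= a w IHw /andP[am lw]; rewrite negb_or => /andP[aNm wm].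
by rewrite IHw // andbT; lia.
Qed.

Lemma not_occurs_semidef m c w : ~~ occurs m w -> semidef m c w.
Proof.
by elim: w => //= a w IHw; rewrite negb_or => /andP[/negPf -> wm]; apply: IHw.
Qed.

Variable l : seq (braid n).
Hypothesis Xl : forall g, X g -> g \in l.

Definition definable m := forall p w, inside X p w -> low m w -> exists w' e,
  [/\ inside X p w', braid_of w' = braid_of w, low m w' & semidef_below m e w'].

(** Induction on the weight of [P]. Its last letter of index [m] and the first such letter of [Q]
    bound a handle; [definable m] makes the interior semidefinite one index below, as [handle]
    requires. *)
Lemma append_opposite m b p P Q : definable m ->
    inside X p (P ++ Q) -> low m.+1 (P ++ Q) -> semidef m b P -> semidef m (~~ b) Q ->
  exists w e, [/\ inside X p w, braid_of w = braid_of (P ++ Q),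
                  low m.+1 w & semidef m e w].
Proof.
move=> IH; have [N] := ubnP (weight l m b p P).
elim: N P Q => // N IHN P Q; rewrite ltnS => PN pPQ lPQ sP sQ.
have [oP|oP] := boolP (occurs m P); last first.
  exists (P ++ Q), (~~ b); split=> //.
  by rewrite /semidef all_cat -!/(semidef _ _ _) sQ not_occurs_semidef.
have [oQ|oQ] := boolP (occurs m Q); last first.
  exists (P ++ Q), b; split=> //.
  by rewrite /semidef all_cat -!/(semidef _ _ _) sP not_occurs_semidef.
have [P1 [[i c] [v1 [PE im o1]]]] := split_last oP.
have [v2 [[i' c'] [Q1 [QE im' o2]]]] := split_first oQ.
rewrite /= in im im'.
have ii' : i' = i by apply/val_inj; rewrite /= im im'.
subst i' P Q.
move: sP sQ; rewrite /semidef !all_cat /= im eqxx /=.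
move=> /and3P[sP1 /eqP cb sv1] /and3P[sv2 /eqP cb' sQ1]; subst c c'.
move: lPQ; rewrite /low !all_cat /= => /andP[/and3P[lP1 _ lv1] /and3P[lv2 _ lQ1]].
have {o1}lv1 : low m v1 by apply: not_occurs_low.
have {o2}lv2 : low m v2 by apply: not_occurs_low.
have wE : (P1 ++ (i, b) :: v1) ++ v2 ++ (i, ~~ b) :: Q1
        = P1 ++ ((i, b) :: rcons (v1 ++ v2) (i, ~~ b)) ++ Q1.
  by rewrite -!catA /= -cats1 -!catA.
rewrite wE in pPQ *; move/inside_cat: (pPQ) => [pP1 /inside_cat[]].
rewrite -cats1 -cat_cons inside_cat => -[pv pi] pQ1.
have := pv => -[/= Xp1 pv12].
have lv12 : low m (v1 ++ v2) by rewrite /low all_cat -!/(low _ _) lv1.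
have [v' [e [pv' v'E lv' sv']]] := IH _ _ pv12 lv12.
have [||| u [pu uE lu su]] := @handle (p * braid_of P1) i b e v'.
- rewrite -cats1 -cat_cons inside_cat; split=> //.
  by move: pi; rewrite !braid_of_cons v'E.
- by rewrite im.
- by rewrite im.
have uE' : braid_of u = braid_of ((i, b) :: rcons (v1 ++ v2) (i, ~~ b)).
  by rewrite uE -!cats1 !braid_of_cons !braid_of_cat v'E braid_of_cat.
rewrite im in lu su.
have pNew : inside X p (P1 ++ u ++ Q1).
  by rewrite !inside_cat uE' -cats1; split=> //; split.
have lNew : low m.+1 (P1 ++ u ++ Q1).
  by rewrite /low !all_cat lP1 lQ1 andbT.
have newE : braid_of (P1 ++ u ++ Q1)
    = braid_of (P1 ++ ((i, b) :: (v1 ++ v2) ++ [:: (i, ~~ b)]) ++ Q1).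
  by rewrite !(braid_of_cat P1) (braid_of_cat u) uE' -cats1 -braid_of_cat.
(* The word [u] replacing the handle joins [Q] or [P] according to its sign. In the first case [P]
   simply loses an edge. *)
have [eb|eb] := eqVneq e b; last first.
  have {}eb : e = ~~ b by move: eb; case: (e); case: (b).
  subst e; rewrite -newE; apply: IHN => //.
    apply: leq_trans PN; rewrite weight_cat /= im eqxx.
    by rewrite -[X in X < _]addn0 ltn_add2l addn_gt0 expn_gt0.
  by rewrite /semidef all_cat sQ1 andbT.
subst e; rewrite -newE catA; apply: IHN => //; try by rewrite -catA.
  apply: leq_trans PN; rewrite !weight_cat /= im eqxx ltn_add2l.
  rewrite (weight_low _ _ _ lv1) addn0.
  have wb := weight_bound Xl pu lu su.
  have := rank_gen Xl (inside_end pu) (a := (i, b)) im erefl.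
  (* As [u] equals the whole handle, following it by the letter [(i, b)] undoes the last letter. The
     vertex reached has the rank of the end of the removed edge, so all the new edges end strictly
     below it. *)
  have -> : p * braid_of P1 * braid_of u * gen i b
          = p * braid_of P1 * gen i b * braid_of v'.
    rewrite uE braid_of_cons -cats1 braid_of_cat -!mulgA; do 3 congr (_ * _).
    by rewrite -[braid_of [:: _]]/(gen i (~~ b)) genVK mulg1.
  rewrite (rank_low _ _ _ lv') => lt_r; apply: leq_trans (leq_pexp2l (isT : 0 < 2) lt_r).
  apply: leq_trans wb; rewrite -[X in X < _]addn0 ltn_add2l.
  by rewrite expn_gt0.
by rewrite /semidef all_cat sP1.
Qed.

(** Letters are appended one at a time; a letter contradicting the sign of the prefix is a path [Q]
    of length one for [append_opposite]. *)
Lemma definable_all m : definable m.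
Proof.
elim: m => [|m IHm] p w.
  by case: w => // pw _; exists [::], true.
elim/last_ind: w => [|w a IHw] pw lw; first by exists [::], true.
move: pw lw; rewrite -cats1 inside_cat /low all_cat => -[pw pa] /andP[lw].
rewrite /= andbT => am; have [P [b [pP PE lP sP]]] := IHw pw lw.
have pPa : inside X p (P ++ [:: a]) by rewrite inside_cat PE.
have lPa : low m.+1 (P ++ [:: a]) by rewrite /low all_cat -/(low _ _) lP /= am.
rewrite braid_of_cat -PE -braid_of_cat.
have [ab|ab] := boolP ((a.1 == m :> nat) ==> (a.2 == b)).
  exists (P ++ [:: a]), b; split=> //.
  by rewrite /semidef_below all_cat -/(semidef_below _ _ _) sP /= ab.
apply: (append_opposite IHm pPa lPa sP).
move: ab; rewrite negb_imply /= => /andP[_].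
by case: a.2; case: (b); rewrite /= ?implybT.
Qed.
End Inside.

(** If the highest generator disappears from the reduced word, the argument restarts one index lower
    with a region chosen for the new word. *)
Lemma braid_trichotomy w : braid_equiv w [::] \/ exists m b w',
  [/\ braid_equiv w w', low m.+1 w', semidef m b w' & occurs m w'].
Proof.
have [m] : exists m, low m w by exists n.-1; apply/allP => a _; apply: ltn_ord.
elim: m w => [|m IHm] w lw.
  by left; case: w lw => // _; apply: BE_refl.
have [X [l [p [HX Xl pX]]]] := braid_region w.
have pw : inside X p w.
  have : forall u v, w = u ++ v -> inside X (p * braid_of u) v.
    move=> u v; elim: v u => [|a v IHv] u wE; first by split=> //; apply: pX wE.
    split; first exact: pX wE.
    have := IHv (rcons u a).
    by rewrite -cats1 -catA braid_of_cat mulgA braid_of_cons mulg1; apply.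
  by move=> /(_ [::] w erefl); rewrite mulg1.
have [w' [b [_ wE lw' sw']]] := definable_all HX Xl pw lw.
have ww' : braid_equiv w w' by apply/braid_ofP.
have [ow|ow] := boolP (occurs m w'); first by right; exists m, b, w'.
case: (IHm w' (not_occurs_low lw' ow)) => [e|[m' [b' [u [e lu su ou]]]]].
  by left; apply: BE_trans e.
by right; exists m', b', u; split=> //; apply: BE_trans e.
Qed.
End Comparison.

(** * The algorithm as a register program *)

(** Clamping at 0 suffices to express maxima, as [max x y = y + max 0 (x - y)]. *)
Record instr (R : Type) :=
  Instr { dst : R; lhs : R; rhs : R; sub : bool; clamp : bool }.

Definition rename (R S : Type) (f : R -> S) (c : instr R) : instr S :=
  Instr (f (dst c)) (f (lhs c)) (f (rhs c)) (sub c) (clamp c).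

Definition outcome (R : Type) (st : R -> Z) (c : instr R) : Z :=
  let z := (if sub c then st (lhs c) - st (rhs c) else st (lhs c) + st (rhs c))%Z in
  if clamp c then Z.max 0 z else z.

Definition exec (R : eqType) (st : R -> Z) (c : instr R) : R -> Z :=
  fun r => if r == dst c then outcome st c else st r.

(* Slots 0-3 stand for [x_i], [y_i], [x_(i+1)], [y_(i+1)], slot 4 for the
   constant [0]; slot 7 receives the quantity [N] of [cross_plus], slot 8 the new
   [x_i] and slot 6 the new [x_(i+1)].  A negative crossing is conjugated by
   [mirror]. *)
Definition crossing_program (b : bool) : seq (instr nat) :=
  let add d l r := Instr d l r false false in
  let adp d l r := Instr d l r false true in
  let sbt d l r := Instr d l r true false in
  let sbp d l r := Instr d l r true true in
  let mirror_x := [:: Instr 0 4 0 (~~ b) false; Instr 2 4 2 (~~ b) false] in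
  mirror_x ++
  [:: adp 5 1 4; adp 6 3 4;
      add 7 0 5; add 7 7 6; add 8 2 1; sbp 8 8 7; add 7 7 8;
      add 6 0 6; sbp 8 2 6; add 6 6 8;
      sbp 8 2 0; add 8 0 8; add 8 8 1; sbp 8 8 0; add 8 8 0;
      add 5 2 1; add 5 5 3; sbt 5 5 7;
      sbt 6 3 6; add 6 6 0; add 6 6 2;
      sbt 3 7 2; add 2 6 4; add 0 8 4; add 1 5 4] ++
  mirror_x.

Definition exec_seq (s : seq Z) (c : instr nat) : seq Z :=
  set_nth 0%Z s (dst c) (outcome (nth 0%Z s) c).

Lemma crossing_programP b (p q : Z * Z) (r0 r1 r2 r3 : Z) :
  let s := foldl exec_seq [:: p.1; p.2; q.1; q.2; 0; r0; r1; r2; r3]%Z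
                          (crossing_program b) in
  let c := cross b p q in
  [/\ nth 0%Z s 0 = c.1.1, nth 0%Z s 1 = c.1.2, nth 0%Z s 2 = c.2.1,
      nth 0%Z s 3 = c.2.2 & nth 0%Z s 4 = 0%Z].
Proof.
case: p q => [x y] [z t]; case: b.
  by lazy -[Z.max Z.add Z.sub Z.opp]; split; lia.
by lazy -[Z.max Z.add Z.sub Z.opp]; split; lia.
Qed.

Section Rename.
Variables (R : eqType) (r0 : R) (ps : seq R).
Hypothesis ps_uniq : uniq ps.
Implicit Types (st : R -> Z) (s : seq Z) (c : instr nat) (p : seq (instr nat)).

Definition bounded (m : nat) c := [&& dst c < m, lhs c < m & rhs c < m].

Let agree st s := size s = size ps /\
  forall k, k < size ps -> st (nth r0 ps k) = nth 0%Z s k.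
Let run st p := foldl (@exec R) st [seq rename (nth r0 ps) c | c <- p].

(** Distinct places ensure that writing one slot does not alter another. *)
Lemma exec_rename st s p : all (bounded (size ps)) p -> agree st s ->
  agree (run st p) (foldl exec_seq s p).
Proof.
rewrite /run; elim: p st s => //= c p IHp st s /andP[/and3P[dc lc rc] bp] [sz st_s].
apply: IHp => //; split=> [|k kp].
  by rewrite size_set_nth sz; apply/maxn_idPr.
rewrite /exec /exec_seq nth_set_nth /= nth_uniq //; case: eqP => _; last exact: st_s.
by rewrite /outcome /= !st_s.
Qed.

Lemma exec_rename_notin st p r :
  all (bounded (size ps)) p -> r \notin ps -> run st p r = st r.
Proof.
rewrite /run => + rps; elim: p st => //= c p IHp st /andP[/and3P[dc _ _] bp].
by rewrite IHp // /exec /= ifN //; apply: contraNneq rps => ->; apply: mem_nth.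
Qed.
End Rename.

(** * The order read from the coordinates, and their registers *)

Section Decision.
Variable n : nat.
Implicit Types (u v w : braid_word n).

Lemma max_positiveP w : max_positive w <->
  exists m, [/\ low m.+1 w, semidef m true w & occurs m w].
Proof.
split=> [[i [iw Niw wi]]|[m [/allP lw /allP sw /hasP[a aw /eqP am]]]].
  exists i; split.
  - by apply/allP => a /wi; rewrite ltnS.
  - apply/allP => -[j []] jw; apply/implyP => //= /eqP ji.
    by move: Niw; rewrite -(val_inj ji) jw.
  - by apply/hasP; exists (i, true) => /=.
exists a.1; split.
- by have := sw _ aw; rewrite am eqxx /= => /eqP <-; rewrite -surjective_pairing.
- by apply/negP => /sw /=; rewrite am eqxx.
- by move=> c /lw; rewrite am ltnS.
Qed.

(** The tested word represents the inverse of the braid in [braid_lt], hence the sign [false].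
    Conversely, the trichotomy supplies a definite word, whose sign is forced by [leading_uniq]. *)
Lemma braid_ltP u v : braid_lt (braid_of u) (braid_of v) <->
  leading false (act start (inv_word v ++ u)).
Proof.
have inv_semi m b w : semidef m b w -> semidef m (~~ b) (inv_word w).
  rewrite /semidef /inv_word all_rev all_map; apply: sub_all => a /=.
  by rewrite (inj_eq negb_inj).
have inv_low m w : low m w -> low m (inv_word w).
  by rewrite /low /inv_word all_rev all_map.
have inv_occ m w : occurs m w -> occurs m (inv_word w).
  by rewrite /occurs /inv_word has_rev has_map.
split.
  case=> w [wE /max_positiveP[m [lw sw ow]]].
  rewrite (_ : act _ _ = act start (inv_word w)).
    by apply: leading_semidef (inv_low _ _ lw) (inv_semi _ _ _ sw) (inv_occ _ _ ow).
  apply: act_equiv; apply/braid_ofP; rewrite braid_of_cat !braid_of_inv wE.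
  by rewrite monoid.invgM monoid.invgK.
move=> lead; case: (braid_trichotomy (inv_word v ++ u)) => [e|[m [b [w [e lw sw ow]]]]].
  by move: lead; rewrite (act_equiv _ e) => -[k [/=]].
have := leading_semidef lw sw ow; rewrite -(act_equiv _ e); case: b sw => sw l'.
  by case: (leading_uniq lead).
exists (inv_word w); split.
  move/braid_ofP: e; rewrite braid_of_cat !braid_of_inv => <-.
  by rewrite monoid.invgM monoid.invgK.
apply/max_positiveP; exists m.
by split; [exact: inv_low | exact: (inv_semi m false) | exact: inv_occ].
Qed.

Lemma act_outside w k : n <= k -> act start w k = start k.
Proof.
move=> nk; move: start => x; elim: w x => //= a w IHw x.
rewrite -/(act _ w) IHw act1_far //; have := ltn_ord a.1; lia.
Qed.

(* Register [inl (k, false)] holds the coordinate [x_k], register [inl (k, true)]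
   the coordinate [y_k]; register [inr 0] holds [0], the others are scratch. *)
Definition reg := ('I_n * bool + 'I_5)%type.

Definition pos_lo (i : 'I_n.-1) : 'I_n := widen_ord (leq_pred n) i.

Lemma pos_hi_subproof (i : 'I_n.-1) : i.+1 < n.
Proof. by have := ltn_ord i; lia. Qed.

Definition pos_hi (i : 'I_n.-1) : 'I_n := Ordinal (pos_hi_subproof i).

Definition zero_reg : reg := inr (@Ordinal 5 0 isT).

Definition places (i : 'I_n.-1) : seq reg :=
  [:: inl (pos_lo i, false); inl (pos_lo i, true);
      inl (pos_hi i, false); inl (pos_hi i, true);
      zero_reg; inr (@Ordinal 5 1 isT); inr (@Ordinal 5 2 isT);
      inr (@Ordinal 5 3 isT); inr (@Ordinal 5 4 isT)].

Definition program (a : letter n) : seq (instr reg) :=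
  [seq rename (nth zero_reg (places a.1)) c | c <- crossing_program a.2].

Definition holds (st : reg -> Z) (x : nat -> Z * Z) : Prop :=
  (forall k : 'I_n, st (inl (k, false)) = (x k).1 /\ st (inl (k, true)) = (x k).2) /\
  st zero_reg = 0%Z.

Lemma places_uniq i : uniq (places i).
Proof.
have lohi : (pos_lo i == pos_hi i) = false by rewrite -val_eqE /=; lia.
have inlE (p q : 'I_n * bool) : (inl p == inl q :> reg) = (p == q) by [].
by rewrite /= !inE !inlE !xpair_eqE lohi !eqxx.
Qed.

Lemma program_holds st x a :
  holds st x -> holds (foldl (@exec reg) st (program a)) (act1 x a).
Proof.
case=> stx st0.
have [lo1 lo2] := stx (pos_lo a.1); have [hi1 hi2] := stx (pos_hi a.1).
have pb : all (bounded (size (places a.1))) (crossing_program a.2) by case: a.2.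
have out := fun r => @exec_rename_notin _ zero_reg _ st _ r pb.
have [|_] := @exec_rename _ zero_reg _ (places_uniq a.1) st
  [seq st r | r <- places a.1] _ pb.
  by split; [rewrite size_map | move=> k kp; rewrite (nth_map zero_reg)].
rewrite [map st _]/= lo1 lo2 hi1 hi2 st0.
have := crossing_programP a.2 (x a.1) (x a.1.+1)
  (st (inr (@Ordinal 5 1 isT))) (st (inr (@Ordinal 5 2 isT)))
  (st (inr (@Ordinal 5 3 isT))) (st (inr (@Ordinal 5 4 isT))).
move: out; rewrite /program.
move: (foldl _ st _) => st'.
move: (foldl exec_seq _ _) => s' out [c0 c1 c2 c3 c4] st_s.
split; last by rewrite -c4 -(st_s 4).
move=> k; rewrite /act1; case: eqP => [kE|kNlo].
  have -> : k = pos_lo a.1 by apply: val_inj.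
  by rewrite -c0 -c1 -(st_s 0) // -(st_s 1).
case: eqP => [kE|kNhi].
  have -> : k = pos_hi a.1 by apply: val_inj.
  by rewrite -c2 -c3 -(st_s 2) // -(st_s 3).
have notin b : inl (k, b) \notin places a.1.
  have inlE (p q : 'I_n * bool) : (inl p == inl q :> reg) = (p == q) by [].
  rewrite !inE !inlE !xpair_eqE; apply/negP.
  do !case/orP=> //; case/andP => /eqP kE _;
    by [apply: kNlo; rewrite kE | apply: kNhi; rewrite kE].
by rewrite !out.
Qed.

End Decision.

(** * Arithmetic on digit cells *)

Lemma mod_balanced (M z : Z) : (2 * Z.abs z < M)%Z ->
  (z mod M = if z <? 0 then z + M else z)%Z.
Proof.
move=> zM; have [z0|z0] := Z.ltb_spec z 0; last by rewrite Z.mod_small; lia.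
by apply/esym/(Z.mod_unique _ _ (-1)); [left|]; lia.
Qed.

Lemma mod_negative (M z : Z) :
  (2 * Z.abs z < M)%Z -> (M <=? 2 * (z mod M))%Z = (z <? 0)%Z.
Proof.
move=> zM; rewrite mod_balanced //; have [z0|z0] := Z.ltb_spec z 0.
  by apply/Z.leb_le; lia.
by apply/Z.leb_gt; lia.
Qed.

Section Digits.
Variables (R : finType) (half : nat).
Hypothesis half_gt0 : 0 < half.

(** An even base lets the top digit alone determine the sign. *)
Definition base := half.*2.

Lemma base_gt0 : 0 < base.
Proof. by rewrite /base double_gt0. Qed.

Definition cell := {ffun R -> 'I_base}.
Implicit Types (cs : seq cell) (r : R) (c : cell) (q : instr R) (st : R -> Z).

Definition value cs r : Z :=
  foldr (fun c v => Z.of_nat (c r) + Z.of_nat base * v)%Z 0%Z cs.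

Definition set_digit c r (d : 'I_base) : cell := [ffun s => if s == r then d else c s].

Definition digit (m : nat) : 'I_base := Ordinal (ltn_pmod m base_gt0).

(** Subtraction adds the complementary digits; [instr_cells] supplies the missing 1 as the initial
    carry. *)
Definition digit_sum q (carry : bool) c : nat :=
  c (lhs q) + (if sub q then base.-1 - c (rhs q) else c (rhs q)) + carry.

Definition right_cell q carry c : cell :=
  set_digit c (dst q) (digit (digit_sum q carry c)).

Definition right_carry q carry c : bool := base <= digit_sum q carry c.

Fixpoint right_cells q carry cs : seq cell :=
  if cs is c :: cs' then
    right_cell q carry c :: right_cells q (right_carry q carry c) cs'
  else [::].

Definition negative r c : bool := half <= c r.

Definition top_negative r cs : bool := last false [seq negative r c | c <- cs].

Definition left_cell q (neg : bool) c : cell :=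
  if clamp q && neg then set_digit c (dst q) (digit 0) else c.

(** The sweep to the right computes the result; the sign is known only at its end, so clamping is
    left to the sweep back. *)
Definition instr_cells q cs : seq cell :=
  let cs' := right_cells q (sub q) cs in
  [seq left_cell q (top_negative (dst q) cs') c | c <- cs'].

Definition modulus cs : Z := (Z.of_nat base ^ Z.of_nat (size cs))%Z.

(* Base-complement notation: the bound makes [st r] the only representative of
   its residue of absolute value less than half the modulus. *)
Definition represents cs st : Prop :=
  forall r, value cs r = (st r mod modulus cs)%Z /\ (2 * Z.abs (st r) < modulus cs)%Z.

Lemma modulus_cons c cs : modulus (c :: cs) = (Z.of_nat base * modulus cs)%Z.
Proof. by rewrite /modulus [size _]/= Nat2Z.inj_succ Z.pow_succ_r //; lia. Qed.

Lemma modulus_gt0 cs : (0 < modulus cs)%Z.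
Proof. by apply: Z.pow_pos_nonneg; have := base_gt0; lia. Qed.

Lemma value_bounds cs r : (0 <= value cs r < modulus cs)%Z.
Proof.
elim: cs => [|c cs IHcs] //; rewrite modulus_cons /=.
have := ltn_ord (c r); have := base_gt0; move: IHcs; nia.
Qed.

Lemma modulus_even c cs : exists K, modulus (c :: cs) = (2 * K)%Z.
Proof. by exists (Z.of_nat half * modulus cs)%Z; rewrite modulus_cons /base; lia. Qed.

(** Half the modulus is a multiple of the weight of the top digit, so the lower digits cannot affect
    the comparison. *)
Lemma top_negativeE c cs r :
  top_negative r (c :: cs) = (modulus (c :: cs) <=? 2 * value (c :: cs) r)%Z.
Proof.
elim: cs c => [|d cs IHcs] c.
  rewrite modulus_cons (_ : modulus [::] = 1%Z) // -[LHS]/(half <= c r).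
  rewrite -[value _ _]/(Z.of_nat (c r) + Z.of_nat base * 0)%Z.
  by case: Z.leb_spec; rewrite /base; lia.
rewrite -[LHS]/(top_negative r (d :: cs)) IHcs [in RHS]modulus_cons.
rewrite -[value (c :: _) r]/(Z.of_nat (c r) + Z.of_nat base * value (d :: cs) r)%Z.
have [K ->] := modulus_even d cs; have := ltn_ord (c r).
move: (value _ _) (nat_of_ord _) => v m; have := base_gt0; move: base => b b0 mb.
by do 2 case: Z.leb_spec => //; nia.
Qed.

Lemma value_eq0 cs r : (value cs r = 0)%Z <-> ~~ has (fun c => c r != 0 :> nat) cs.
Proof.
elim: cs => //= c cs IHcs; rewrite negb_or negbK.
have := value_bounds cs r; have := base_gt0.
split=> [e|/andP[/eqP -> /IHcs ->]]; last by lia.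
apply/andP; split; first by apply/eqP; nia.
by apply/IHcs; nia.
Qed.

Lemma size_right_cells q carry cs : size (right_cells q carry cs) = size cs.
Proof. by elim: cs carry => //= c cs IHcs carry; rewrite IHcs. Qed.

(** The outgoing carry is kept explicit and later vanishes modulo the modulus. A cell is read before
    it is overwritten, so [dst] may coincide with an operand. *)
Lemma value_right_cells_dst q carry cs : exists carry' : bool,
  (value (right_cells q carry cs) (dst q) + modulus cs * Z.of_nat carry' =
   value cs (lhs q)
   + (if sub q then modulus cs - 1 - value cs (rhs q) else value cs (rhs q))
   + Z.of_nat carry)%Z.
Proof.
elim: cs carry => [|c cs IHcs] carry.
  by exists carry; case: (sub q); case: carry.
have [carry' e] := IHcs (right_carry q carry c); exists carry'.
rewrite modulus_cons /= /set_digit ffunE eqxx.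
have sE : Z.of_nat (digit (digit_sum q carry c)) = (Z.of_nat (digit_sum q carry c)
    - Z.of_nat base * Z.of_nat (right_carry q carry c))%Z.
  rewrite /right_carry /=; have : digit_sum q carry c < base + base.
    rewrite /digit_sum; have := ltn_ord (c (lhs q)); have := ltn_ord (c (rhs q)).
    by move: (leq_b1 carry); case: (sub q); lia.
  case: (leqP base (digit_sum q carry c)) => [le_bs lt_s|lt_s _].
    have -> : digit_sum q carry c %% base = digit_sum q carry c - base.
      by rewrite -[in LHS](subnK le_bs) modnDr modn_small //; lia.
    by lia.
  by rewrite modn_small //=; lia.
rewrite sE /digit_sum; have := ltn_ord (c (rhs q)).
have := f_equal (Z.mul (Z.of_nat base)) e.
by case: (sub q) => e' ?; lia.
Qed.

Lemma value_right_cells r q carry cs :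
  r != dst q -> value (right_cells q carry cs) r = value cs r.
Proof.
move=> rd; elim: cs carry => //= c cs IHcs carry.
by rewrite IHcs ffunE (negPf rd).
Qed.

Lemma represents_negative cs st r : 0 < size cs -> represents cs st ->
  top_negative r cs = (st r <? 0)%Z.
Proof.
case: cs => // c cs _ /(_ r) [vE bound].
by rewrite top_negativeE vE mod_negative.
Qed.

Lemma represents_nonzero cs st r : represents cs st ->
  has (fun c => c r != 0 :> nat) cs = negb (st r =? 0)%Z.
Proof.
move=> /(_ r) [vE bound]; apply/idP/idP; apply: contraTT; rewrite ?negbK.
  move/Z.eqb_eq => e; apply/value_eq0; rewrite vE e Z.mod_0_l //.
  by have := modulus_gt0 cs; lia.
move/value_eq0; rewrite vE mod_balanced // => e; apply/Z.eqb_eq.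
by move: e; case: Z.ltb_spec; lia.
Qed.

(** The bound on the operands rules out overflow, so the residue of the result determines the result
    itself. *)
Lemma instr_cells_represents q cs st : 0 < size cs -> represents cs st ->
  (2 * (Z.abs (st (lhs q)) + Z.abs (st (rhs q))) < modulus cs)%Z ->
  represents (instr_cells q cs) (exec st q).
Proof.
move=> cs0 rep bound r.
have mE : modulus (instr_cells q cs) = modulus cs.
  by rewrite /modulus /instr_cells size_map size_right_cells.
have M0 := modulus_gt0 cs.
pose z := (if sub q then st (lhs q) - st (rhs q) else st (lhs q) + st (rhs q))%Z.
have -> : exec st q r = if r == dst q then if clamp q then Z.max 0 z else z else st r.
  by [].
rewrite mE.
have zb : (2 * Z.abs z < modulus cs)%Z by rewrite {}/z; case: (sub q); lia.
set cs' := right_cells q (sub q) cs.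
have vz : value cs' (dst q) = (z mod modulus cs)%Z.
  have [carry e] := value_right_cells_dst q (sub q) cs.
  have [el _] := rep (lhs q); have [er _] := rep (rhs q).
  have vb := value_bounds cs' (dst q).
  have -> : value cs' (dst q) = (value cs' (dst q) mod modulus cs)%Z.
    rewrite Z.mod_small //; move: vb.
    by rewrite /cs' /modulus size_right_cells.
  have -> : value cs' (dst q) = (value cs (lhs q)
   + (if sub q then - value cs (rhs q) else value cs (rhs q))
   + (Z.of_nat (sub q) - Z.of_nat carry) * modulus cs)%Z.
    move: e; rewrite -/cs'; move: (value _ _) (value _ _) (value _ _) (modulus cs).
    by clear; case: (sub q) => ? ? ? ?; lia.
  rewrite Z_mod_plus_full /z el er; case: (sub q).
    by rewrite Z.add_opp_r -Zminus_mod.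
  by rewrite -Zplus_mod.
have top : top_negative (dst q) cs' = (z <? 0)%Z.
  have : size cs' = size cs by apply: size_right_cells.
  case: (cs') vz => [|c cs''] vz sz; first by move: cs0; rewrite -sz.
  rewrite top_negativeE vz; have -> : modulus (c :: cs'') = modulus cs.
    by rewrite /modulus sz.
  by rewrite mod_negative.
have vleft cs0' s : value [seq left_cell q (z <? 0)%Z c | c <- cs0'] s
    = if clamp q && (z <? 0)%Z && (s == dst q) then 0%Z else value cs0' s.
  elim: cs0' => [|c cs0' /= ->]; first by case: ifP.
  rewrite /left_cell; case: (clamp q && _) => //=.
  by rewrite ffunE; case: eqP => //= _; rewrite mod0n; lia.
rewrite /instr_cells -/cs' top vleft; have [->|rd] := eqVneq r (dst q).
  rewrite andbT; case: (clamp q) => /=; last by rewrite vz.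
  case: Z.ltb_spec => z0; last by rewrite vz Z.max_r.
  by rewrite Z.max_l ?Z.mod_0_l; try (split=> //); lia.
rewrite andbF value_right_cells //; exact: rep.
Qed.

End Digits.

(** * The Turing machine *)

(** Both signs give the same length: for a positive letter the two [mirror] passes become additions
    of 0. *)
Definition program_length := 29.

Section State.
Variable n : nat.

(* The first argument of [Fetch], [SweepR] and [SweepL] is [false] while [v] is
   read from right to left with its letters inverted, [true] while [u] is read
   from left to right.  The letter and the index designate an instruction of its
   program; the last boolean tells whether the last digit written is in the upper
   half, i.e., after the last cell, whether the result is negative. *)
Inductive tm_state : Type :=
| Start | Fill | Rewind | Skip
| Fetch of bool
| SweepR of bool & letter n & 'I_program_length & bool & bool
| SweepL of bool & letter n & 'I_program_length & bool
| Final of {ffun 'I_n -> bool * bool}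
| Done of bool.

Definition state_code := ('I_4 + bool
  + (bool * letter n * 'I_program_length * bool * bool)
  + (bool * letter n * 'I_program_length * bool)
  + {ffun 'I_n -> bool * bool} + bool)%type.

Definition encode_state (q : tm_state) : state_code :=
  match q with
  | Start => inl (inl (inl (inl (inl (@Ordinal 4 0 isT)))))
  | Fill => inl (inl (inl (inl (inl (@Ordinal 4 1 isT)))))
  | Rewind => inl (inl (inl (inl (inl (@Ordinal 4 2 isT)))))
  | Skip => inl (inl (inl (inl (inl (@Ordinal 4 3 isT)))))
  | Fetch d => inl (inl (inl (inl (inr d))))
  | SweepR d a pc c f => inl (inl (inl (inr (d, a, pc, c, f))))
  | SweepL d a pc f => inl (inl (inr (d, a, pc, f)))
  | Final s => inl (inr s)
  | Done b => inr b
  end.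

Definition decode_state (c : state_code) : tm_state :=
  match c with
  | inl (inl (inl (inl (inl k)))) =>
      match val k with 0 => Start | 1 => Fill | 2 => Rewind | _ => Skip end
  | inl (inl (inl (inl (inr d)))) => Fetch d
  | inl (inl (inl (inr (d, a, pc, c, f)))) => SweepR d a pc c f
  | inl (inl (inr (d, a, pc, f))) => SweepL d a pc f
  | inl (inr s) => Final s
  | inr b => Done b
  end.

Lemma encode_stateK : cancel encode_state decode_state.
Proof. by case. Qed.

HB.instance Definition _ := Finite.copy tm_state (can_type encode_stateK).
End State.

Arguments Start {n}.
Arguments Fill {n}.
Arguments Rewind {n}.
Arguments Skip {n}.
Arguments Fetch {n}.
Arguments Done {n}.

Section Machine.
Variables (n half : nat).
Hypothesis half_gt0 : 0 < half.
Notation cell := (cell (reg n) half).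
Notation state := (tm_state n).
Notation symbol := (option (letter n) + cell)%type.

(** In base-complement notation -1 has all digits maximal, so the same cell initialises every
    column. *)
Definition cell0 : cell :=
  [ffun r : reg n => if r is inl (_, true) then digit half_gt0 (base half).-1
                     else digit half_gt0 0].

Definition instr_at (a : letter n) (pc : nat) : instr (reg n) :=
  nth (Instr (zero_reg n) (zero_reg n) (zero_reg n) false false) (program a) pc.

Definition begin_instr (d : bool) (a : letter n) (pc : 'I_program_length) : state :=
  SweepR d a pc (sub (instr_at a pc)) false.

Definition flags0 : {ffun 'I_n -> bool * bool} := [ffun=> (false, false)].

(** The first flag remembers any nonzero digit; the second is overwritten at each cell, so that the
    top digit decides the sign. *)
Definition update_flags (s : {ffun 'I_n -> bool * bool}) (c : cell) :=
  [ffun k => ((s k).1 || (c (inl (k, false)) != 0 :> nat),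
              negative (inl (k, false)) c)].

Definition decision (s : {ffun 'I_n -> bool * bool}) : bool :=
  [exists k : 'I_n, [&& (s k).1, ~~ (s k).2 &
                       [forall j : 'I_n, (k < j) ==> ~~ (s j).1]]].

(** [Fill] lays one cell per input symbol and ends with the input head on the last letter of [v].
    After [v] is consumed leftwards, [Skip] crosses [u], which is then read rightwards until the
    separator starts [Final]. *)
Definition transition (q : state) (i w : option symbol) :
    state * move * (option symbol * move) :=
  match q with
  | Start => (Fill, Stay, (w, Right))
  | Fill => if i is Some _ then (Fill, Right, (Some (inr cell0), Right))
            else (Rewind, Left, (w, Left))
  | Rewind => if w is Some _ then (Rewind, Stay, (w, Left))
              else (Fetch false, Stay, (w, Right))
  | Fetch d =>
      match i with
      | Some (inl (Some a)) =>
          (begin_instr d (a.1, if d then a.2 else ~~ a.2) (@Ordinal program_length 0 isT),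
           Stay, (w, Stay))
      | Some (inl None) =>
          if d then (Final flags0, Stay, (w, Stay)) else (Skip, Left, (w, Stay))
      | _ => (q, Stay, (w, Stay))
      end
  | Skip => if i is Some _ then (Skip, Left, (w, Stay))
            else (Fetch true, Right, (w, Stay))
  | SweepR d a pc c f =>
      let p := instr_at a pc in
      if w is Some (inr x) then
        let y := right_cell half_gt0 p c x in
        (SweepR d a pc (right_carry p c x) (negative (dst p) y),
         Stay, (Some (inr y), Right))
      else (SweepL d a pc f, Stay, (w, Left))
  | SweepL d a pc f =>
      if w is Some (inr x) then
        (q, Stay, (Some (inr (left_cell half_gt0 (instr_at a pc) f x)), Left))
      else if insub pc.+1 is Some pc' then
        (begin_instr d a pc', Stay, (w, Right))
      else (Fetch d, if d then Right else Left, (w, Right))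
  | Final s =>
      if w is Some (inr x) then (Final (update_flags s x), Stay, (w, Right))
      else (Done (decision s), Stay, (w, Stay))
  | Done b => (q, Stay, (w, Stay))
  end.

Definition braid_machine : machine (option (letter n)) :=
  @Machine (option (letter n)) 1 cell state Start
    (fun q => if q is Done b then Some b else None)
    (fun q f =>
       let: (q', m, act) := transition q (f ord0) (f ord_max) in
       (q', [ffun k : 'I_2 => if k == ord0 then (f ord0, m) else act])).

Definition cfg (q : state) (ti tw : tape symbol) : config braid_machine :=
  @Config _ braid_machine q [ffun k : 'I_2 => if k == ord0 then ti else tw].

Lemma step_cfg q ti tw q' m act : (if q is Done _ then False else True) ->
  transition q (cur ti) (cur tw) = (q', m, act) ->
  step (cfg q ti tw) = cfg q' (write_move ti (cur ti, m)) (write_move tw act).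
Proof.
move=> nd dE; rewrite /step /=.
have -> : (match q with Done b => Some b | _ => None end) = None by case: q nd {dE}.
rewrite !ffunE /= dE; congr Config.
by apply/ffunP => k; rewrite !ffunE; case: eqP.
Qed.

Lemma write_stay (t : tape symbol) : write_move t (cur t, Stay) = t.
Proof. by case: t. Qed.

Lemma init_cfg x : init_config braid_machine x =
  cfg Start (input_tape braid_machine x) (Tape [::] None [::]).
Proof. by []. Qed.

(** Tapes are compared as lists, so the blanks at which the sweeps turn around are written
    explicitly. *)
Definition wtape (L cs : seq cell) : tape symbol :=
  let r := [seq Some (inr c) | c <- cs] ++ [:: None] in
  Tape ([seq Some (inr c) | c <- L] ++ [:: None]) (head None r) (behead r).

Definition wtape_left (cs : seq cell) : tape symbol :=
  Tape [::] None ([seq Some (inr c) | c <- cs] ++ [:: None]).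

Lemma wtape_right L c cs d : write_move (wtape L (c :: cs)) (Some (inr d), Right)
  = wtape (d :: L) cs.
Proof. by []. Qed.

Lemma wtape_left_write L c d cs :
  write_move (wtape L (d :: cs)) (Some (inr c), Left)
  = if L is e :: L' then wtape L' (e :: c :: cs) else wtape_left (c :: cs).
Proof. by case: L. Qed.

Lemma sweep_right d a (pc : 'I_program_length) c f ti L cs :
  let p := instr_at a pc in
  let out := right_cells half_gt0 p c cs in
  iter (size cs).+1 (@step _ _) (cfg (SweepR d a pc c f) ti (wtape L cs)) =
  cfg (SweepL d a pc (last f [seq negative (dst p) x | x <- out])) ti
      (write_move (wtape (rev out ++ L) [::]) (None, Left)).
Proof.
move=> p out; rewrite {}/out.
elim: cs c f L => [|x cs IHcs] c f L.
  rewrite [iter _ _ _]/=.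
  by rewrite (@step_cfg (SweepR d a pc c f) ti (wtape L [::]) _ _ _ I erefl) write_stay.
rewrite iterSr (@step_cfg (SweepR d a pc c f) ti (wtape L (x :: cs)) _ _ _ I erefl).
rewrite write_stay wtape_right IHcs; congr (cfg _ _ (write_move (wtape _ _) _)).
by rewrite rev_cons cat_rcons.
Qed.

Lemma sweep_left d a (pc : 'I_program_length) f ti L c cs :
  iter (size L).+1 (@step _ _) (cfg (SweepL d a pc f) ti (wtape L (c :: cs))) =
  cfg (SweepL d a pc f) ti (wtape_left
    ([seq left_cell half_gt0 (instr_at a pc) f x | x <- rev (c :: L)] ++ cs)).
Proof.
elim: L c cs => [|e L IHL] c cs.
  rewrite [iter _ _ _]/=.
  by rewrite (@step_cfg (SweepL d a pc f) ti (wtape [::] (c :: cs)) _ _ _ I erefl) write_stay.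
rewrite iterSr (@step_cfg (SweepL d a pc f) ti (wtape (e :: L) (c :: cs)) _ _ _ I erefl).
rewrite write_stay wtape_left_write IHL; congr (cfg _ _ (wtape_left _)).
by rewrite [in RHS]rev_cons map_rcons cat_rcons.
Qed.

Definition reach (t : nat) (c c' : config braid_machine) : Prop :=
  iter t (@step _ _) c = c'.

Lemma reach_trans t t' c c' c'' : reach t c c' -> reach t' c' c'' -> reach (t + t') c c''.
Proof. by rewrite /reach addnC iterD => ->. Qed.

Lemma reach_step q ti tw q' m act :
    (if q is Done _ then False else True) ->
    transition q (cur ti) (cur tw) = (q', m, act) ->
  reach 1 (cfg q ti tw) (cfg q' (write_move ti (cur ti, m)) (write_move tw act)).
Proof. exact: step_cfg. Qed.

Definition go (d : bool) : move := if d then Right else Left.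

Lemma reach_instr d a (pc : 'I_program_length) ti cs : 0 < size cs ->
  let cs' := instr_cells half_gt0 (instr_at a pc) cs in
  reach (size cs).*2.+2 (cfg (begin_instr d a pc) ti (wtape [::] cs))
   (if insub pc.+1 is Some pc' then cfg (begin_instr d a pc') ti (wtape [::] cs')
    else cfg (Fetch d) (write_move ti (cur ti, go d)) (wtape [::] cs')).
Proof.
(* Each sweep takes one step per cell and one on the blank where it turns. *)
move=> cs0; rewrite (_ : _.*2.+2 = (size cs).+1 + (size cs + 1)); last by lia.
apply: reach_trans; first exact: sweep_right.
set out := right_cells _ _ _ _; rewrite cats0.
have sz : size (rev out) = size cs by rewrite size_rev size_right_cells.
rewrite /instr_cells -/out -/(top_negative (dst (instr_at a pc)) out).
move: (top_negative _ _) => f; rewrite -[X in [seq _ | _ <- X]]revK.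
case: (rev out) sz => [|e L] sz; first by rewrite -sz in cs0.
rewrite -sz; apply: reach_trans.
  exact: (@sweep_left d a pc f ti L e [::]).
rewrite cats0.
set cs' := [seq _ | _ <- _].
have := @reach_step (SweepL d a pc f) ti (wtape_left cs').
rewrite [cur (wtape_left cs')]/= /transition.
by case: insub => [pc'|] /(_ _ _ _ I erefl); rewrite ?write_stay.
Qed.

Definition run_cells (cs : seq cell) (p : seq (instr (reg n))) : seq cell :=
  foldl (fun (cs : seq cell) (q : instr (reg n)) => instr_cells half_gt0 q cs) cs p.

Lemma size_instr_cells (q : instr (reg n)) (cs : seq cell) :
  size (instr_cells half_gt0 q cs) = size cs.
Proof. by rewrite size_map size_right_cells. Qed.

Lemma size_run_cells cs p : size (run_cells cs p) = size cs.
Proof. by elim: p cs => //= q p IHp cs; rewrite IHp size_instr_cells. Qed.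

Lemma size_program (a : letter n) : size (program a) = program_length.
Proof. by rewrite size_map; case: a.2. Qed.

Lemma reach_program d a (pc : 'I_program_length) ti cs : 0 < size cs ->
  reach ((program_length - pc) * (size cs).*2.+2)
    (cfg (begin_instr d a pc) ti (wtape [::] cs))
    (cfg (Fetch d) (write_move ti (cur ti, go d))
         (wtape [::] (run_cells cs (drop pc (program a))))).
Proof.
have [m] := ubnP (program_length - pc); elim: m pc cs => // m IHm pc cs mpc cs0.
have := reach_instr d a pc ti cs0; have := ltn_ord pc.
set cs' := instr_cells _ _ _ => ltpc.
have sz : size cs' = size cs by apply: size_instr_cells.
have -> : run_cells cs (drop pc (program a)) = run_cells cs' (drop pc.+1 (program a)).
  rewrite [in LHS](drop_nth (Instr (zero_reg n) (zero_reg n) (zero_reg n) false false)).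
    by [].
  by rewrite size_program.
case: insubP => [pc' _ pcE|].
  move=> h; rewrite (_ : _ - pc = (program_length - pc').+1); last first.
    by rewrite /= in pcE *; lia.
  rewrite mulSn; apply: reach_trans h _; rewrite -sz -pcE; apply: IHm; rewrite ?sz //.
  by move: pcE; rewrite /=; lia.
rewrite -leqNgt => le; rewrite (_ : _ - pc = 1); last by lia.
by rewrite mul1n drop_oversize // size_program.
Qed.

Definition letter_time (W : nat) := (program_length * W.*2.+2).+1.

Lemma reach_letter d a ti cs : 0 < size cs -> cur ti = Some (inl (Some a)) ->
  reach (letter_time (size cs)) (cfg (Fetch d) ti (wtape [::] cs))
    (cfg (Fetch d) (write_move ti (cur ti, go d))
         (wtape [::] (run_cells cs (program (a.1, if d then a.2 else ~~ a.2))))).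
Proof.
move=> cs0 tiE; rewrite /letter_time -add1n.
apply: (@reach_trans _ _ _
  (cfg (begin_instr d (a.1, if d then a.2 else ~~ a.2) (@Ordinal program_length 0 isT))
       ti (wtape [::] cs))).
  have := @reach_step (Fetch d) ti (wtape [::] cs); rewrite tiE /=.
  by move=> /(_ _ _ _ I erefl); rewrite -tiE !write_stay.
exact: (@reach_program d _ (@Ordinal program_length 0 isT)).
Qed.

Definition tapeL (Ls Rs : seq (option symbol)) : tape symbol :=
  Tape (behead Ls) (head None Ls) Rs.

Definition tapeR (Ls Rs : seq (option symbol)) : tape symbol :=
  Tape Ls (head None Rs) (behead Rs).

Let inp (a : option (letter n)) : option symbol := Some (inl a).

Lemma reach_fill (s : seq (option (letter n))) Ls L :
  reach (size s) (cfg Fill (tapeR Ls [seq inp a | a <- s]) (wtape L [::]))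
    (cfg Fill (tapeR (rev [seq inp a | a <- s] ++ Ls) [::])
              (wtape (nseq (size s) cell0 ++ L) [::])).
Proof.
elim: s Ls L => [|a s IHs] Ls L; first by [].
rewrite [size _]/= -add1n; apply: reach_trans.
  exact: (@reach_step Fill (tapeR Ls [seq inp a | a <- a :: s]) (wtape L [::]) _ _ _ I erefl).
have -> : nseq (size s).+1 cell0 ++ L = nseq (size s) cell0 ++ (cell0 :: L).
  by elim: (size s) => //= k IHk; congr cons.
rewrite map_cons rev_cons cat_rcons; exact: (IHs (inp a :: Ls) (cell0 :: L)).
Qed.

Lemma reach_rewind ti L c cs :
  reach (size L).+2 (cfg Rewind ti (wtape L (c :: cs)))
    (cfg (Fetch false) ti (wtape [::] (rev (c :: L) ++ cs))).
Proof.
elim: L c cs => [|e L IHL] c cs.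
  apply: (@reach_trans 1 1).
    exact: (@reach_step Rewind ti (wtape [::] (c :: cs)) _ _ _ I erefl).
  rewrite write_stay wtape_left_write.
  have := @reach_step Rewind ti (wtape_left (c :: cs)) _ _ _ I erefl.
  by rewrite write_stay.
rewrite [size _]/= -add1n; apply: reach_trans.
  exact: (@reach_step Rewind ti (wtape (e :: L) (c :: cs)) _ _ _ I erefl).
by rewrite write_stay wtape_left_write [rev _]rev_cons cat_rcons; apply: IHL.
Qed.

Definition programs (w : braid_word n) := flatten [seq program a | a <- w].

Lemma run_cells_cat cs p p' : run_cells cs (p ++ p') = run_cells (run_cells cs p) p'.
Proof. exact: foldl_cat. Qed.

Lemma reach_backward (w : braid_word n) Ls Rs cs : 0 < size cs ->
  reach (size w * letter_time (size cs))
    (cfg (Fetch false) (tapeL ([seq inp (Some a) | a <- w] ++ Ls) Rs) (wtape [::] cs))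
    (cfg (Fetch false) (tapeL Ls (rev [seq inp (Some a) | a <- w] ++ Rs))
       (wtape [::] (run_cells cs (programs [seq (a.1, ~~ a.2) | a <- w])))).
Proof.
elim: w Rs cs => // a w IHw Rs cs cs0; rewrite mulSn; apply: reach_trans.
  exact: reach_letter.
rewrite -[programs _]/(program _ ++ programs _) run_cells_cat map_cons rev_cons cat_rcons.
rewrite -{1}(size_run_cells cs (program (a.1, ~~ a.2))).
by apply: IHw; rewrite size_run_cells.
Qed.

Lemma reach_forward (w : braid_word n) Ls Rs cs : 0 < size cs ->
  reach (size w * letter_time (size cs))
    (cfg (Fetch true) (tapeR Ls ([seq inp (Some a) | a <- w] ++ Rs)) (wtape [::] cs))
    (cfg (Fetch true) (tapeR (rev [seq inp (Some a) | a <- w] ++ Ls) Rs)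
       (wtape [::] (run_cells cs (programs w)))).
Proof.
elim: w Ls cs => // a w IHw Ls cs cs0; rewrite mulSn; apply: reach_trans.
  exact: reach_letter.
rewrite -[programs _]/(program a ++ programs _) run_cells_cat map_cons rev_cons cat_rcons.
rewrite -surjective_pairing.
by rewrite -{1}(size_run_cells cs (program a)); apply: IHw; rewrite size_run_cells.
Qed.

Lemma reach_skip (s : seq (option (letter n))) Rs tw :
  reach (size s) (cfg Skip (tapeL [seq inp a | a <- s] Rs) tw)
    (cfg Skip (tapeL [::] (rev [seq inp a | a <- s] ++ Rs)) tw).
Proof.
elim: s Rs => // a s IHs Rs; rewrite [size _]/= -add1n; apply: reach_trans.
  exact: (@reach_step Skip (tapeL [seq inp a | a <- a :: s] Rs) tw _ _ _ I erefl).
rewrite write_stay map_cons rev_cons cat_rcons; exact: IHs.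
Qed.

Lemma reach_final s ti L cs :
  reach (size cs).+1 (cfg (Final s) ti (wtape L cs))
    (cfg (Done (decision (foldl update_flags s cs))) ti (wtape (rev cs ++ L) [::])).
Proof.
elim: cs s L => [|c cs IHcs] s L.
  have := @reach_step (Final s) ti (wtape L [::]) _ _ _ I erefl.
  by rewrite write_stay.
rewrite [size _]/= -add1n; apply: reach_trans.
  exact: (@reach_step (Final s) ti (wtape L (c :: cs)) _ _ _ I erefl).
rewrite write_stay rev_cons cat_rcons; exact: (IHcs (update_flags s c) (c :: L)).
Qed.

(** The summands follow the phases: start, filling, its end, rewinding, [v], separator, skipping
    [u], its end, [u], separator, final sweep. The width [W] counts both words and the separator. *)
Definition running_time (l : nat) : nat :=
  let W := l.*2.+1 in
  1 + (W + (1 + (W.+1 + (l * letter_time W + (1 + (l + (1 +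
  (l * letter_time W + (1 + W.+1))))))))).

Lemma reach_answer (u v : braid_word n) l : size u = l -> size v = l ->
  let cs := run_cells (nseq l.*2.+1 cell0) (programs (inv_word v ++ u)) in
  exists ti tw, reach (running_time l)
    (init_config braid_machine (encode_pair u v))
    (cfg (Done (decision (foldl update_flags flags0 cs))) ti tw).
Proof.
move=> ul vl cs; rewrite /running_time init_cfg.
set x := encode_pair u v; set W := l.*2.+1.
have xW : size x = W by rewrite size_cat /= !size_map ul vl /W; lia.
have -> : input_tape braid_machine x = tapeR [::] [seq inp a | a <- x] by [].
pose U := [seq inp (Some a) | a <- u]; pose V := [seq inp (Some a) | a <- rev v].
have xE : rev [seq inp a | a <- x] = V ++ inp None :: rev U.
  by rewrite /x /encode_pair map_cat map_cons rev_cat rev_cons cat_rcons -!map_comp /V map_rev.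
pose cs1 := run_cells (nseq W cell0) (programs (inv_word v)).
have sz0 : size (nseq W cell0) = W by rewrite size_nseq.
have sz1 : size cs1 = W by rewrite size_run_cells.
have csE : cs = run_cells cs1 (programs u).
  by rewrite -run_cells_cat -flatten_cat -map_cat.
have szs : size cs = W by rewrite size_run_cells.
have invE : [seq (a.1, ~~ a.2) | a <- rev v] = inv_word v by rewrite map_rev.
do 2 eexists; apply: reach_trans.
  exact: (@reach_step Start (tapeR [::] [seq inp a | a <- x]) (Tape [::] None [::])
            _ _ _ I erefl).
rewrite write_stay; apply: reach_trans.
  by have := @reach_fill x [::] [::]; rewrite xW; apply.
rewrite !cats0; apply: reach_trans.
  exact: (@reach_step Fill (tapeR (rev [seq inp a | a <- x]) [::])
            (wtape (nseq W cell0) [::]) _ _ _ I erefl).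
apply: reach_trans.
  by have := @reach_rewind (tapeL (rev [seq inp a | a <- x]) [:: None])
               (nseq l.*2 cell0) cell0 [::]; rewrite size_nseq; apply.
rewrite cats0 -[_ :: nseq _ _]/(nseq W cell0) rev_nseq xE; apply: reach_trans.
  have := @reach_backward (rev v) (inp None :: rev U) [:: None] (nseq W cell0).
  by rewrite sz0 size_rev vl invE; apply.
rewrite -/cs1; apply: reach_trans.
  exact: (@reach_step (Fetch false) (tapeL (inp None :: rev U) (rev V ++ [:: None]))
            (wtape [::] cs1) _ _ _ I erefl).
rewrite write_stay; apply: reach_trans.
  have := @reach_skip (rev [seq Some a | a <- u]) (inp None :: rev V ++ [:: None])
            (wtape [::] cs1).
  by rewrite size_rev size_map ul map_rev -map_comp; apply.
rewrite revK; apply: reach_trans.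
  exact: (@reach_step Skip (tapeL [::] (U ++ inp None :: rev V ++ [:: None]))
            (wtape [::] cs1) _ _ _ I erefl).
rewrite write_stay; apply: reach_trans.
  have := @reach_forward u [:: None] (inp None :: rev V ++ [:: None]) cs1.
  by rewrite sz1 ul; apply.
rewrite -csE; apply: reach_trans.
  exact: (@reach_step (Fetch true)
            (tapeR (rev U ++ [:: None]) (inp None :: rev V ++ [:: None])) (wtape [::] cs) _ _ _ I erefl).
rewrite write_stay -szs; exact: reach_final.
Qed.

End Machine.

(** * Absence of overflow, correctness and the quadratic bound *)

Section Correctness.
Variables (n half : nat).
Hypothesis half_gt0 : 0 < half.
Notation cell := (cell (reg n) half).

(** One instruction at most doubles the largest absolute value. *)
Lemma run_cells_represents p (cs : seq cell) (st : reg n -> Z) (M : Z) :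
    0 < size cs -> represents cs st -> (forall r, Z.abs (st r) <= M)%Z ->
    (2 * (M * 2 ^ Z.of_nat (size p)) < modulus cs)%Z ->
  represents (run_cells half_gt0 cs p) (foldl (@exec (reg n)) st p).
Proof.
elim: p cs st M => [//|q p IHp] cs st M cs0 rep stM.
rewrite [size _]/= Nat2Z.inj_succ Z.pow_succ_r; last by lia.
have M0 : (0 <= M)%Z by have := stM (zero_reg n); lia.
have pow0 : (1 <= 2 ^ Z.of_nat (size p))%Z.
  by have := Z.pow_pos_nonneg 2 (Z.of_nat (size p)); lia.
have MP := Z.mul_le_mono_nonneg_l _ _ M M0 pow0.
move=> bound; apply: (IHp (instr_cells half_gt0 q cs) (exec st q) (2 * M)%Z).
- by rewrite size_instr_cells.
- apply: instr_cells_represents => //.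
  have arith (a b P N : Z) : (Z.abs a <= M -> Z.abs b <= M -> M * 1 <= M * P ->
      2 * (M * (2 * P)) < N -> 2 * (Z.abs a + Z.abs b) < N)%Z by lia.
  exact: arith (stM _) (stM _) MP bound.
- move=> r; rewrite /exec /outcome.
  have arith (a b : Z) : (Z.abs a <= M -> Z.abs b <= M ->
      Z.abs (if clamp q then Z.max 0 (if sub q then a - b else a + b)
             else if sub q then a - b else a + b) <= 2 * M)%Z.
    by case: (sub q); case: (clamp q); lia.
  by case: eqP => _; [exact: arith (stM _) (stM _) | have := stM r; lia].
- by rewrite {1}/modulus size_instr_cells; move: bound; rewrite /modulus; lia.
Qed.

Definition start_regs (r : reg n) : Z := if r is inl (_, true) then (-1)%Z else 0%Z.

Lemma start_regs_holds : holds start_regs start.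
Proof. by []. Qed.

Lemma cell0_represents W : 1 < half -> 0 < W ->
  represents (nseq W (cell0 n half_gt0)) start_regs.
Proof.
move=> half1 W0 r.
have mod_gt2 : (2 < modulus (nseq W (cell0 n half_gt0)))%Z.
  case: W W0 => // W _; rewrite modulus_cons //.
  have := modulus_gt0 half_gt0 (nseq W (cell0 n half_gt0)).
  by move: (modulus _) => M; rewrite /base; nia.
have vE k : value (nseq k (cell0 n half_gt0)) r
    = if r is inl (_, true) then (modulus (nseq k (cell0 n half_gt0)) - 1)%Z else 0%Z.
  elim: k => [|k IHk]; first by case: r => [[i []]|t].
  rewrite -[LHS]/(Z.of_nat (cell0 n half_gt0 r)
    + Z.of_nat (base half) * value (nseq k (cell0 n half_gt0)) r)%Z.
  have -> : cell0 n half_gt0 r = (if r is inl (_, true) then (base half).-1 else 0) :> nat.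
    have b0 := base_gt0 half_gt0.
    by rewrite ffunE; case: (r) => [[i []]|t] /=; rewrite modn_small // prednK.
  rewrite IHk modulus_cons //; have := base_gt0 half_gt0.
  by move: (modulus _) => M; case: (r) => [[i []]|t]; lia.
rewrite vE {vE}; move: mod_gt2; move: (modulus _) => M M2.
case: r => [[i []]|t]; rewrite /start_regs.
- rewrite mod_balanced; last by lia.
  by rewrite (_ : (-1 <? 0)%Z = true) //; lia.
- by rewrite Z.mod_0_l; lia.
- by rewrite Z.mod_0_l; lia.
Qed.

Lemma programs_holds st x (w : braid_word n) : holds st x ->
  holds (foldl (@exec (reg n)) st (programs w)) (act x w).
Proof.
elim: w st x => // a w IHw st x h.
rewrite -[programs _]/(program a ++ programs w) foldl_cat.
exact/IHw/program_holds.
Qed.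

Lemma size_programs (w : braid_word n) :
  size (programs w) = program_length * size w :> nat.
Proof.
elim: w => [|a w IHw]; first by rewrite muln0.
rewrite -[programs _]/(program a ++ programs w) size_cat IHw size_program.
by rewrite [size (a :: w)]/= mulnS.
Qed.

Lemma foldl_flags (cs : seq cell) s k :
  foldl (@update_flags n half) s cs k =
  ((s k).1 || has (fun c : cell => c (inl (k, false)) != 0 :> nat) cs,
   last (s k).2 [seq negative (inl (k, false)) c | c <- cs]).
Proof.
elim: cs s => [|c cs IHcs] s /=; first by rewrite orbF -surjective_pairing.
by rewrite IHcs ffunE /= orbA.
Qed.

Lemma decision_leading (cs : seq cell) st x :
    0 < size cs -> represents cs st -> holds st x ->
    (forall k, n <= k -> (x k).1 = 0%Z) ->
  decision (foldl (@update_flags n half) (flags0 n) cs) <-> leading false x.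
Proof.
move=> cs0 rep [stx _] out.
have fE k : foldl (@update_flags n half) (flags0 n) cs k
    = (negb ((x k).1 =? 0)%Z, ((x k).1 <? 0)%Z).
  rewrite foldl_flags ffunE /= (represents_nonzero half_gt0 _ rep).
  have := represents_negative half_gt0 (inl (k, false)) cs0 rep.
  by rewrite /top_negative => ->; rewrite (stx k).1.
rewrite /decision; split.
  move=> /existsP[k]; rewrite fE /= => /and3P[k1 k2 /forallP kj].
  exists k; split.
    by rewrite /signed; move: k1 k2; case: Z.eqb_spec; case: Z.ltb_spec; lia.
  move=> j kltj; have [jn|nj] := ltnP j n; last exact: out.
  by have := kj (Ordinal jn); rewrite kltj fE /= negbK => /Z.eqb_eq.
move=> [k [sk kj]]; have [kn|nk] := ltnP k n; last first.
  by move: sk; rewrite /signed out //; lia.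
apply/existsP; exists (Ordinal kn); rewrite fE /=; apply/and3P; split.
- by move: sk; rewrite /signed; case: Z.eqb_spec; lia.
- by move: sk; rewrite /signed; case: Z.ltb_spec; lia.
- by apply/forallP => j; apply/implyP => kltj; rewrite fE /= negbK kj.
Qed.

Hypothesis half_big : 2 ^ program_length <= half.

(** A letter multiplies the bound by [2 ^ program_length], while its cell multiplies the modulus by
    at least [2 ^ program_length.+1]. The cell of the separator leaves room for the sign. *)
Lemma machine_decides : decides_braid_lt_in (braid_machine n half_gt0) running_time.
Proof.
move=> l u v ul vl; set w := inv_word v ++ u.
have [ti [tw run]] := reach_answer half_gt0 ul vl.
set cs0 := nseq l.*2.+1 (cell0 n half_gt0) in run.
set cs := run_cells _ _ _ in run.
exists (decision (foldl (@update_flags n half) (flags0 n) cs)); split.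
  by rewrite /answers_within run.
rewrite braid_ltP; have sz0 : 0 < size cs0 by rewrite size_nseq.
apply: (decision_leading (st := foldl (@exec (reg n)) start_regs (programs w))).
- by rewrite size_run_cells.
- apply: (run_cells_represents (M := 1%Z)) => //.
  + apply: cell0_represents => //; apply: leq_trans half_big.
    by rewrite -[1]/(2 ^ 0) ltn_exp2l.
  + by case=> [[k []]|k].
  + rewrite Z.mul_1_l size_programs /modulus size_nseq.
    have -> : size w = l.*2 by rewrite size_cat size_rev size_map ul vl addnn.
    move: half_big; rewrite /base; have : 0 < program_length by [].
    move: program_length => P P0 halfP.
    have powZ k : Z.of_nat (2 ^ k) = (2 ^ Z.of_nat k)%Z.
      elim: k => // k IHk; rewrite expnS Nat2Z.inj_succ Z.pow_succ_r; last by lia.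
      by rewrite -IHk; lia.
    have baseP : (2 ^ Z.of_nat P.+1 <= Z.of_nat half.*2)%Z.
      by rewrite -powZ expnS; lia.
    have := Z.pow_le_mono_l _ _ (Z.of_nat l.*2.+1)
              (conj (Z.pow_nonneg 2 _ ltac:(lia)) baseP).
    apply: Z.lt_le_trans; rewrite -Z.pow_mul_r -?Z.pow_succ_r; try lia.
    by apply: Z.pow_lt_mono_r; nia.
- exact/programs_holds/start_regs_holds.
- by move=> k nk; rewrite act_outside.
Qed.

End Correctness.

Lemma running_time_quadratic : bigO running_time (fun l => l ^ 2).
Proof.
(* The time is [232 l^2 + 241 l + 10], at most [483 l^2] once [l] is positive. *)
exists 500, 1 => l l1; rewrite /running_time /letter_time /program_length.
by rewrite -!muln2; nia.
Qed.

Theorem theoremB :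
  forall n : nat,
  exists (M : machine (option (letter n))) (T : nat -> nat),
    decides_braid_lt_in M T /\ bigO T (fun l => l ^ 2)%N.
Proof.
(* Keeping [half] abstract avoids computing [2 ^ 29] in unary. *)
move=> n; have [half half_big] : exists half, 2 ^ program_length <= half.
  by eexists; apply: leqnn.
have half_gt0 : 0 < half by apply: leq_trans half_big; rewrite expn_gt0.
exists (braid_machine n half_gt0), running_time; split.
  exact: (@machine_decides n half half_gt0 half_big).
exact: running_time_quadratic.
Qed.
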